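(* Let $\Phi\in\mathcal{Y}$ and let $\varphi_1,\varphi_2:(0,\infty)\to(0,\infty)$ be measurable functions. Suppose there is a constant $C>0$, independent of $r$, such that for all $r>0$ $$\sup_{r<t<\infty}\Phi^{-1}(t^{-Q})\,\operatorname*{ess\,inf}_{t<s<\infty}\frac{\varphi_1(s)}{\Phi^{-1}(s^{-Q})}\le C\,\varphi_2(r).$$ Then the maximal operator $M$ is bounded from $M_{\Phi,\varphi_1}(X)$ to $WM_{\Phi,\varphi_2}(X)$; and if $\Phi\in\nabla_2$, then $M$ is bounded from $M_{\Phi,\varphi_1}(X)$ to $M_{\Phi,\varphi_2}(X)$.
   Context: $(X,d,\mu)$ is a space of homogeneous type: $X$ is a topological space with a quasi-distance $d$ (i.e. $d(x,y)\ge 0$, $d(x,y)=0$ iff $x=y$, $d(x,y)=d(y,x)$, $d(x,y)\le K_1(d(x,z)+d(z,y))$) and a positive measure $\mu$; the balls $B(x,r)=\{y\in X:d(x,y)<r\}$, $r>0$, form a basis of neighborhoods of $x$; $\mu$ is defined on a $\sigma$-algebra containing the balls, and $0<\mu(B(x,2r))\le K_2\mu(B(x,r))<\infty$; $K_1,K_2\ge1$ are constants independent of $x,y,z,r$. Standing assumptions: $\mu(X)=\infty$; the compactly supported continuous functions are dense in $L_1(X,\mu)$; $X$ is $Q$-homogeneous for some $Q>0$, i.e. $K_3^{-1}r^Q\le\mu(B(x,r))\le K_3r^Q$ for all $x\in X$, $r>0$, with a constant $K_3\ge1$. A Young function is a convex, left-continuous $\Phi:[0,\infty)\to[0,\infty]$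 with $\lim_{r\to+0}\Phi(r)=\Phi(0)=0$ and $\lim_{r\to\infty}\Phi(r)=\infty$. $\mathcal{Y}$ is the set of Young functions with $0<\Phi(r)<\infty$ for $0<r<\infty$. $\Phi^{-1}(s)=\inf\{r\ge0:\Phi(r)>s\}$ ($\inf\emptyset=\infty$). $\Phi\in\nabla_2$ means $\Phi(r)\le\frac1{2k}\Phi(kr)$ for all $r\ge0$, for some $k>1$. $L_\Phi(X)$ is the set of $f\in L_1^{\rm loc}(X)$ with $\int_X\Phi(\epsilon|f|)d\mu<\infty$ for some $\epsilon>0$, with $\|f\|_{L_\Phi}=\inf\{\lambda>0:\int_X\Phi(|f(x)|/\lambda)d\mu(x)\le1\}$. $WL_\Phi(X)$ is the set of $f\in L_1^{\rm loc}(X)$ with $\sup_{r>0}\Phi(r)\,d_{\epsilon f}(r)<\infty$ for some $\epsilon>0$, with $\|f\|_{WL_\Phi}=\inf\{\lambda>0:\sup_{t>0}\Phi(t/\lambda)d_f(t)\le1\}$, where $d_f(t)=\mu(\{x\in X:|f(x)|>t\})$. For a ball $B$: $\|f\|_{L_\Phi(B)}=\|f\chi_B\|_{L_\Phi}$, $\|f\|_{WL_\Phi(B)}=\|f\chi_B\|_{WL_\Phi}$. $L_\Phi^{\rm loc}(X)$ (resp. $WL_\Phi^{\rm loc}(X)$) is the set of $f$ with $f\chi_B\in L_\Phi(X)$ (resp. $WL_\Phi(X)$) for all balls $B$. For a positive measurable $\varphi$ on $(0,\infty)$, $M_{\Phi,\varphi}(X)$ is the set of $f\in L_\Phi^{\rm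 loc}(X)$ with $\|f\|_{M_{\Phi,\varphi}}=\sup_{x\in X,r>0}\varphi(r)^{-1}\Phi^{-1}(\mu(B(x,r))^{-1})\|f\|_{L_\Phi(B(x,r))}<\infty$, and $WM_{\Phi,\varphi}(X)$ is the set of $f\in WL_\Phi^{\rm loc}(X)$ with $\|f\|_{WM_{\Phi,\varphi}}=\sup_{x\in X,r>0}\varphi(r)^{-1}\Phi^{-1}(\mu(B(x,r))^{-1})\|f\|_{WL_\Phi(B(x,r))}<\infty$. $Mf(x)=\sup_{r>0}\frac1{\mu(B(x,r))}\int_{B(x,r)}|f(y)|d\mu(y)$. An operator $T$ is bounded from $A$ to $A'$ if there is $C>0$ with $\|Tf\|_{A'}\le C\|f\|_A$ for all $f\in A$. *)

(* Defs.v *)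
From HB Require Import structures.
From mathcomp Require Import all_boot all_order all_algebra.
From mathcomp Require Import all_classical all_reals all_analysis.
From mathcomp Require Import measurable_realfun ess_sup_inf.

Set Implicit Arguments.
Unset Strict Implicit.
Unset Printing Implicit Defensive.

Import Order.TTheory GRing.Theory Num.Theory.
Import numFieldNormedType.Exports.

Local Open Scope classical_set_scope.
Local Open Scope ring_scope.
Local Open Scope ereal_scope.

(* No compatibility between the topology and the sigma-algebra is built in:
   they are only related through the balls, in [homogeneous_type] below.
   [Measurable] entails pointedness, which costs nothing as mu X = +oo. *)
#[short(type="topMeasurableType")]
HB.structure Definition TopMeasurable (disp : measure_display) :=
  {T of Topological T & Measurable disp T}.

Section homogeneous_type.
Context (R : realType) (disp : measure_display) (X : topMeasurableType disp).
Variables (mu : {measure set X -> \bar R}) (d : X -> X -> R).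

Definition qball (x : X) (r : R) : set X := [set y | (d x y < r)%R].

Definition quasi_distance (K1 : R) : Prop :=
  [/\ forall x y, (0 <= d x y)%R,
      forall x y, d x y = 0%R <-> x = y,
      forall x y, d x y = d y x &
      forall x y z, (d x y <= K1 * (d x z + d z y))%R].

Definition homogeneous_type : Prop :=
  [/\ exists2 K1 : R, (1 <= K1)%R & quasi_distance K1,
      forall (x : X) (A : set X),
        nbhs x A <-> exists2 r : R, (0 < r)%R & qball x r `<=` A,
      forall x r, (0 < r)%R -> measurable (qball x r) &
      exists2 K2 : R, (1 <= K2)%R & forall x r, (0 < r)%R ->
        [/\ 0 < mu (qball x (2 * r)),
            mu (qball x (2 * r)) <= K2%:E * mu (qball x r) &
            K2%:E * mu (qball x r) < +oo]].

Definition Cc_dense_in_L1 : Prop :=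
  forall f : X -> R, mu.-integrable setT (EFin \o f) ->
  forall eps : R, (0 < eps)%R ->
  exists g : X -> R,
    [/\ continuous g, compact (closure [set x | g x != 0%R]),
        mu.-integrable setT (EFin \o g) &
        \int[mu]_x `|(f x - g x)%:E| < eps%:E].

Definition Q_homogeneous (Q : R) : Prop :=
  exists2 K3 : R, (1 <= K3)%R & forall x r, (0 < r)%R ->
    (K3^-1 * r `^ Q)%:E <= mu (qball x r) <= (K3 * r `^ Q)%:E.

End homogeneous_type.

Section young.
Context (R : realType).
Implicit Types Phi : R -> \bar R.

(* A function on [0, +oo[ is represented by a function on R of which only the
   values at nonnegative reals are used. *)
Definition young Phi : Prop :=
  [/\ forall r, (0 <= r)%R -> 0 <= Phi r,
      forall a b t, (0 <= a)%R -> (0 <= b)%R -> (0 <= t <= 1)%R ->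
        Phi (t * a + (1 - t) * b)%R <= t%:E * Phi a + (1 - t)%:E * Phi b,
      forall r, (0 < r)%R -> Phi x @[x --> r^'-] --> Phi r,
      Phi 0%R = 0 /\ Phi x @[x --> 0%R^'+] --> 0 &
      Phi x @[x --> +oo%R] --> +oo].

Definition young_Y Phi : Prop :=
  young Phi /\ forall r, (0 < r)%R -> 0 < Phi r < +oo.

Definition nabla2 Phi : Prop :=
  exists2 k : R, (1 < k)%R &
    forall r, (0 <= r)%R -> Phi r <= ((2 * k)^-1)%:E * Phi (k * r)%R.

Definition young_inv Phi (s : \bar R) : \bar R :=
  ereal_inf [set r%:E | r in [set r : R | (0 <= r)%R /\ s < Phi r]].

(* Value of a Young function at an element of [0, +oo]; -oo is irrelevant. *)
Definition young_ext Phi (x : \bar R) : \bar R :=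
  if x is r%:E then Phi r else +oo.

(* Lebesgue measurability: the sigma-algebra on the domain is completed, that
   on the codomain is the Borel one. *)
Definition lebesgue_measurable_pos (phi : R -> R) : Prop :=
  @measurable_fun _ _
    (g_sigma_algebraType (completed_algebra_gen (@lebesgue_measure R))) R
    `]0%R, +oo[ phi.

Definition ess_inf_gt (t : R) (g : R -> \bar R) : \bar R :=
  ess_inf (mrestr lebesgue_measure (measurable_itv `]t, +oo[%R)) g.

End young.

(* The average of |f| over a ball need not depend measurably on its center,
   since no joint measurability of the quasi-distance is assumed.  Hence the
   maximal function may fail to be measurable, and mu and the integral are
   extended from above to arbitrary sets and nonnegative functions (mu^*, see
   [mu_ext], and [upper_integral]).  [distribution_functionE] and
   [upper_integralE] show that nothing changes in the measurable case. *)
Section upper.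
Context (R : realType) (disp : measure_display) (X : measurableType disp).
Variable mu : {measure set X -> \bar R}.

Definition upper_integral (g : X -> \bar R) : \bar R :=
  ereal_inf [set \int[mu]_x h x | h in
    [set h : X -> \bar R | measurable_fun setT h /\ forall x, g x <= h x]].

Definition distribution_function (f : X -> \bar R) (t : R) : \bar R :=
  mu_ext mu [set x | t%:E < `|f x|].

Lemma upper_integralE (g : X -> \bar R) :
  measurable_fun setT g -> (forall x, 0 <= g x) ->
  upper_integral g = \int[mu]_x g x.
Proof.
move=> mg g0; apply/eqP; rewrite eq_le; apply/andP; split.
  by apply: ereal_inf_lbound; exists g.
apply: le_ereal_inf_tmp => _ [h [mh gh] <-].
by apply: ge0_le_integral => // x _; rewrite (le_trans (g0 x)).
Qed.

Lemma distribution_functionE (f : X -> \bar R) (t : R) :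
  measurable_fun setT f ->
  distribution_function f t = mu [set x | t%:E < `|f x|].
Proof.
move=> mf; apply: measurable_mu_extE.
rewrite -[X in measurable X]setTI.
by apply: emeasurable_fun_o_infty => //; exact: measurableT_comp.
Qed.

End upper.

(* Functions take values in [-oo, +oo], so that f and its maximal function can
   be treated alike; local integrability forces f to be finite a.e. *)
Section spaces.
Context (R : realType) (disp : measure_display) (X : topMeasurableType disp).
Variables (mu : {measure set X -> \bar R}) (d : X -> X -> R).
Implicit Types (f : X -> \bar R) (Phi : R -> \bar R) (phi : R -> R).

Definition L1_loc : set (X -> \bar R) :=
  [set f | forall x r, (0 < r)%R -> mu.-integrable setT (f \_ (qball d x r))].

Definition L_Phi Phi : set (X -> \bar R) :=
  [set f | L1_loc f /\ exists2 eps : R, (0 < eps)%R &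
    upper_integral mu (fun x => young_ext Phi (eps%:E * `|f x|)) < +oo].

Definition norm_L_Phi Phi f : \bar R :=
  ereal_inf [set lam%:E | lam in [set lam : R | (0 < lam)%R /\
    upper_integral mu (fun x => young_ext Phi (`|f x| / lam%:E)) <= 1]].

Definition norm_WL_Phi Phi f : \bar R :=
  ereal_inf [set lam%:E | lam in [set lam : R | (0 < lam)%R /\
    ereal_sup [set Phi (t / lam)%R * distribution_function mu f t
              | t in [set t : R | (0 < t)%R]] <= 1]].

Definition L_Phi_loc Phi : set (X -> \bar R) :=
  [set f | forall x r, (0 < r)%R -> L_Phi Phi (f \_ (qball d x r))].

Definition morrey_norm (N : (X -> \bar R) -> \bar R) Phi phi f : \bar R :=
  ereal_sup [set ((phi xr.2)^-1)%:E *
                 young_inv Phi (mu (qball d xr.1 xr.2))^-1 *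
                 N (f \_ (qball d xr.1 xr.2))
            | xr in [set xr : X * R | (0 < xr.2)%R]].

Definition norm_M Phi phi := morrey_norm (norm_L_Phi Phi) Phi phi.

Definition norm_WM Phi phi := morrey_norm (norm_WL_Phi Phi) Phi phi.

Definition orlicz_morrey Phi phi : set (X -> \bar R) :=
  [set f | L_Phi_loc Phi f /\ norm_M Phi phi f < +oo].

Definition maximal f (x : X) : \bar R :=
  ereal_sup [set (mu (qball d x r))^-1 * \int[mu]_(y in qball d x r) `|f y|
            | r in [set r : R | (0 < r)%R]].

(* A : source space, N : its norm, N' : norm of the target space, so that T f
   is only required to have a finite target norm.  Local integrability of T f
   cannot be asked for: for Phi r = r the maximal function of an integrable
   function is in general not locally integrable. *)
Definition bounded_operator (T : (X -> \bar R) -> (X -> \bar R))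
    (A : set (X -> \bar R)) (N N' : (X -> \bar R) -> \bar R) : Prop :=
  exists2 C : R, (0 < C)%R & forall f, A f -> N' (T f) <= C%:E * N f.

End spaces.

(* Main.v *)
(** Fix a ball B(x, r).  For y in B(x, r), the balls B(y, s) with s > r lie in
    concentric balls B(x, 2 K s) of comparable measure, so by the modular bound
    the means of |f| over them are at most a constant c proportional to
    phi2(r): monotonicity of the local norms turns the supremum-infimum
    condition into a bound on the norm of f over B(x, t) for all t > r.  The
    balls with s <= r lie in B(x, 2 K r) and only see the restriction f1 of f
    to it.  Hence above the level c the superlevel sets of M f on B(x, r) are
    controlled by a Vitali covering argument applied to f1: with
    |f1| <= t/2 + (t/2) g, the set where M f > t is contained in a measurable
    set of measure at most C0 times the integral of g.  The weak estimate
    chooses g as a multiple of Phi(|f1|/lambda); the strong one chooses g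
    as (2/t) |f1| on the set where |f1| > t/2, at the levels t = c k^j, and
    sums over j, where nabla_2 makes the sum geometric.  Covering sets are
    measurable even if M f is not, so outer measures and upper integrals
    cause no trouble. *)
Require Import Defs.
From mathcomp Require Import all_boot all_order all_algebra.
From mathcomp Require Import all_classical all_reals all_analysis.
From mathcomp Require Import measurable_realfun ring lra.

Set Implicit Arguments.
Unset Strict Implicit.
Unset Printing Implicit Defensive.

Import Order.TTheory GRing.Theory Num.Theory.
Import numFieldNormedType.Exports.

Local Open Scope classical_set_scope.
Local Open Scope ring_scope.
Local Open Scope ereal_scope.

(** * Series of nonnegative extended reals *)

Lemma nneseries_pinfty_ge (R : realType) (u : nat -> \bar R) (e : R) :
  (0 < e)%R -> (forall n, e%:E <= u n) -> \sum_(n <oo) u n = +oo.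
Proof.
move=> e0 eu.
have u0 n : 0 <= u n by apply: le_trans (eu n); rewrite lee_fin ltW.
apply/eqyP => A A0.
pose N := (Num.truncn (A / e)).+1.
apply: le_trans (nneseries_lim_ge N _) => //.
apply: (@le_trans _ _ (\sum_(0 <= i < N) e%:E)); last exact: lee_sum.
rewrite sumEFin big_const_nat subn0 iter_addr addr0 lee_fin -[leRHS]mulr_natl.
by rewrite -ler_pdivrMr// ltW// truncnS_gt.
Qed.

Lemma nneseries_ge_term (R : realType) (u : nat -> \bar R) n :
  (forall i, 0 <= u i) -> u n <= \sum_(i <oo) u i.
Proof.
move=> u0; apply: le_trans (nneseries_lim_ge n.+1 _) => //.
by rewrite big_nat_recr//= leeDr// sume_ge0.
Qed.

(** * Finite positive Young functions and their generalized inverses *)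

Section young_function.
Context (R : realType) (Phi : R -> \bar R).
Hypothesis yPhi : young_Y Phi.

Local Notation F r := (fine (Phi r)).
Local Notation I s := (fine (young_inv Phi s%:E)).

Implicit Types r s t : R.

Lemma young_fin r : (0 <= r)%R -> Phi r = (F r)%:E.
Proof.
case: yPhi => -[_ _ _ [P0 _] _] P r0.
have [->|rn0] := eqVneq r 0%R; first by rewrite P0.
have /P/andP[a b] : (0 < r)%R by rewrite lt_neqAle eq_sym rn0.
by rewrite fineK// ge0_fin_numE// ltW.
Qed.

Lemma young0 : F 0%R = 0%R.
Proof. by case: yPhi => -[_ _ _ [P0 _] _] P; rewrite P0. Qed.

Lemma young_gt0 r : (0 < r)%R -> (0 < F r)%R.
Proof.
case: yPhi => _ P r0; move: (P _ r0) => /andP[+ _].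
by rewrite young_fin ?ltW// lte_fin.
Qed.

Lemma young_ge0 r : (0 <= r)%R -> (0 <= F r)%R.
Proof.
by rewrite le_eqVlt => /orP[/eqP<-|/young_gt0/ltW//]; rewrite young0.
Qed.

(** Convexity between [r] and 0, where [Phi] vanishes. Nearly every later use of convexity goes
    through this form. *)
Lemma young_scale t r : (0 <= t <= 1)%R -> (0 <= r)%R ->
  (F (t * r) <= t * F r)%R.
Proof.
move=> t01 r0; have /andP[t0 t1] := t01.
case: yPhi => -[_ cvx _ [P0 _] _] _.
have := cvx r 0%R t r0 (lexx _) t01.
by rewrite mulr0 addr0 P0 mule0 adde0 (young_fin r0) (young_fin (mulr_ge0 t0 r0)).
Qed.

Lemma young_le r s : (0 <= r)%R -> (r <= s)%R -> (F r <= F s)%R.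
Proof.
move=> r0 rs; have [s0|s0] := leP s 0%R.
  by have -> : r = s by lra.
have t1 : (r / s <= 1)%R by rewrite ler_pdivrMr// mul1r.
have t01 : (0 <= r / s <= 1)%R by rewrite t1 divr_ge0// ltW.
have := young_scale t01 (ltW s0); rewrite divfK ?gt_eqF//.
by move/le_trans; apply; rewrite ler_piMl// young_ge0// ltW.
Qed.

(** The last two clauses replace the identity Phi(Phi^-1(s)) = s: they need no continuity, but say
    nothing at the endpoint [I s] itself, so later arguments always step strictly to one side of
    it. *)
Lemma young_inv_fin s : (0 < s)%R ->
  [/\ young_inv Phi s%:E = (I s)%:E, (0 < I s)%R,
      forall r, (I s < r)%R -> (s < F r)%R &
      forall r, (0 <= r < I s)%R -> (F r <= s)%R].
Proof.
move=> s0; set S := [set r%:E | r in [set r : R | (0 <= r)%R /\ s%:E < Phi r]].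
have F1 : (0 < F 1)%R by exact: young_gt0.
(* By convexity F a is at most a F(1), hence at most [s]: this bounds the inverse away from 0. *)
pose a := Num.min 1%R (s / F 1)%R.
have a0 : (0 < a)%R by rewrite lt_min ltr01 divr_gt0.
have Fa : (F a <= s)%R.
  rewrite -[a]mulr1 (le_trans (young_scale _ _))//.
    by rewrite ltW//= ge_min lexx.
  by rewrite -ler_pdivlMr// ge_min lexx orbT.
have lbS r : (0 <= r)%R -> (s < F r)%R -> ~~ (r < a)%R.
  move=> r0 sF; apply/negP => ra.
  by have := young_le r0 (ltW ra); lra.
have aS : a%:E <= young_inv Phi s%:E.
  apply: le_ereal_inf_tmp => _ [r [r0 sF] <-]; rewrite lee_fin leNgt.
  by apply: lbS => //; rewrite -lte_fin -young_fin.
(* By convexity F b is at least b F(1) = F(1) + s > s, so the inverse is at most [b]. *)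
pose b : R := (1 + s / F 1)%R.
have b1 : (1 < b)%R by rewrite ltrDl divr_gt0.
have Sb : young_inv Phi s%:E <= b%:E.
  apply: ereal_inf_lbound; exists b => //; split; first lra.
  rewrite young_fin ?lte_fin; last lra.
  have bi : (0 <= b^-1 <= 1)%R.
    by rewrite invr_ge0 invf_le1 ?(ltW b1)//=; lra.
  have b0 : (0 <= b)%R by lra.
  have := young_scale bi b0; rewrite mulVf ?gt_eqF//; last by lra.
  rewrite mulrC ler_pdivlMr; last by lra.
  apply: lt_le_trans; rewrite /b mulrDr mulr1 mulrCA divff ?gt_eqF// mulr1.
  by rewrite ltrDr.
have fI : young_inv Phi s%:E = (I s)%:E.
  rewrite fineK// fin_numElt (lt_le_trans _ aS) ?ltNyr//.
  by rewrite (le_lt_trans Sb) ?ltry.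
split => //.
- by rewrite -lte_fin -fI (lt_le_trans _ aS)// lte_fin.
- move=> r Ir; have : ereal_inf S < r%:E by rewrite [ereal_inf _]fI lte_fin.
  move/ereal_inf_lt => [_ [u [u0 su] <-]]; rewrite lte_fin => ur.
  rewrite young_fin// lte_fin in su.
  by apply: (lt_le_trans su); apply: young_le => //; exact: ltW.
- move=> r /andP[r0 rI]; rewrite leNgt; apply/negP => sF.
  have : young_inv Phi s%:E <= r%:E.
    by apply: ereal_inf_lbound; exists r => //; split => //; rewrite young_fin.
  by rewrite fI lee_fin leNgt rI.
Qed.

Lemma young_invr_gt0 s : (0 < s)%R -> (0 < I s)%R.
Proof. by case/young_inv_fin. Qed.

Lemma young_invr_le s t : (0 < s)%R -> (s <= t)%R -> (I s <= I t)%R.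
Proof.
move=> s0 st; have t0 : (0 < t)%R by lra.
have [_ _ _ Hs] := young_inv_fin s0.
have [_ It0 Ht _] := young_inv_fin t0.
apply/ler_addgt0Pr => e e0; rewrite leNgt; apply/negP => h.
have /Hs : (0 <= I t + e < I s)%R by rewrite h andbT; lra.
have /Ht : (I t < I t + e)%R by lra.
by lra.
Qed.

(** A form of concavity of the inverse: at a point r strictly between c I(s) and I(c s), the
    inequalities F(r) <= c s and F(r / c) > s would contradict F(r / c) <= F(r) / c. *)
Lemma young_invr_scale c s : (1 <= c)%R -> (0 < s)%R ->
  (I (c * s) <= c * I s)%R.
Proof.
move=> c1 s0; have c0 : (0 < c)%R by lra.
have [_ _ _ Hs] := young_inv_fin (mulr_gt0 c0 s0).
have [_ Is0 Ht _] := young_inv_fin s0.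
rewrite leNgt; apply/negP => h.
pose r := ((I (c * s) + c * I s) / 2)%R.
have cI : (0 < c * I s)%R by rewrite mulr_gt0.
have /Hs : (0 <= r < I (c * s))%R by apply/andP; split; rewrite /r; lra.
have /Ht : (I s < r / c)%R.
  by rewrite ltr_pdivlMr// mulrC /r; lra.
have ci : (0 <= c^-1 <= 1)%R by rewrite invr_ge0 ltW//= invf_le1.
have r0 : (0 <= r)%R by rewrite /r; lra.
have := young_scale ci r0; rewrite mulrC => h1 h2 h3.
have : (s < c^-1 * F r)%R by exact: lt_le_trans h1.
by rewrite mulrC ltr_pdivlMr// mulrC; lra.
Qed.

(* A substitute for Jensen's inequality: averaging it over a ball bounds the
   mean of a function by its Orlicz modular, at the price of a constant. *)
Lemma young_linear_bound s (x : \bar R) : (0 < s)%R -> 0 <= x ->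
  x <= s%:E + (s / F s)%:E * young_ext Phi x.
Proof.
move=> s0; have Fs := young_gt0 s0; case: x => [v||]//=; last first.
  by rewrite gt0_muley ?lte_fin ?divr_gt0.
rewrite lee_fin => v0; rewrite (young_fin v0) -EFinM -EFinD lee_fin.
have [vs|sv] := leP v s.
  apply: (le_trans vs); rewrite lerDl mulr_ge0 ?young_ge0// divr_ge0 ?ltW//.
have v0' : (0 < v)%R by lra.
(* Beyond [s] the quotient F(v) / v is at least F(s) / s, again by convexity. *)
have sv1 : (0 <= s / v <= 1)%R.
  by rewrite divr_ge0 ?(ltW s0)//= ler_pdivrMr// mul1r ltW.
have := young_scale sv1 v0; rewrite divfK ?gt_eqF// => h.
apply: (@le_trans _ _ (s / F s * F v)%R); last by rewrite lerDr ltW.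
rewrite mulrAC ler_pdivlMr// mulrC.
by rewrite mulrAC ler_pdivlMr// in h.
Qed.

Lemma young_ext_ge0 (x : \bar R) : 0 <= x -> 0 <= young_ext Phi x.
Proof. by case: x => //= r; rewrite lee_fin => r0; rewrite young_fin// lee_fin young_ge0. Qed.

Lemma young_ext_le (x y : \bar R) : 0 <= x -> x <= y ->
  young_ext Phi x <= young_ext Phi y.
Proof.
case: y x => [y||] [x||]//=; rewrite ?leey// ?lee_fin => x0 xy.
by rewrite (young_fin x0) (young_fin (le_trans x0 xy)) lee_fin young_le.
Qed.

Lemma young_ext_scale t (x : \bar R) : (0 < t <= 1)%R -> 0 <= x ->
  young_ext Phi (t%:E * x) <= t%:E * young_ext Phi x.
Proof.
case/andP => t0 t1; case: x => [x||]//=; last first.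
  by rewrite gt0_muley ?lte_fin.
rewrite lee_fin => x0.
rewrite (young_fin x0) (young_fin (mulr_ge0 (ltW t0) x0)) -EFinM lee_fin.
by rewrite young_scale// (ltW t0) t1.
Qed.

End young_function.

(** * Balls of a Q-homogeneous space and the covering argument *)

Section covering.
Context (R : realType) (disp : measure_display) (X : topMeasurableType disp).
Variables (mu : {measure set X -> \bar R}) (d : X -> X -> R) (Q K K3 : R).
Hypotheses (Q0 : (0 < Q)%R) (K_ge1 : (1 <= K)%R) (K3_ge1 : (1 <= K3)%R).
Hypothesis qd : quasi_distance d K.
Hypothesis mball : forall x (r : R), (0 < r)%R -> measurable (qball d x r).
Hypothesis homQ : forall x (r : R), (0 < r)%R ->
  (K3^-1 * r `^ Q)%:E <= mu (qball d x r) <= (K3 * r `^ Q)%:E.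
Implicit Types (x y : X) (r c : R).

Let K_gt0 : (0 < K)%R. Proof. exact: lt_le_trans K_ge1. Qed.
Let K3_gt0 : (0 < K3)%R. Proof. exact: lt_le_trans K3_ge1. Qed.

Lemma qball_r0 x r : (r <= 0)%R -> qball d x r = set0.
Proof.
case: qd => d0 _ _ _ r0; apply/seteqP; split=> // y /= dxy.
by have := d0 x y; rewrite /qball/= in dxy; lra.
Qed.

Lemma qball_measurable x r : measurable (qball d x r).
Proof. by have [/qball_r0 ->//|/mball] := leP r 0%R. Qed.

Lemma qball_fin x r : (0 < r)%R -> mu (qball d x r) = (fine (mu (qball d x r)))%:E.
Proof.
move=> r0; have /andP[_ h] := homQ x r0.
by rewrite fineK// ge0_fin_numE// (le_lt_trans h)// ltry.
Qed.

Lemma qball_lower x r : (0 < r)%R -> (K3^-1 * r `^ Q <= fine (mu (qball d x r)))%R.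
Proof. by move=> r0; have /andP[+ _] := homQ x r0; rewrite qball_fin// lee_fin. Qed.

Lemma qball_upper x r : (0 < r)%R -> (fine (mu (qball d x r)) <= K3 * r `^ Q)%R.
Proof. by move=> r0; have /andP[_] := homQ x r0; rewrite qball_fin// lee_fin. Qed.

Lemma qball_gt0 x r : (0 < r)%R -> (0 < fine (mu (qball d x r)))%R.
Proof.
move=> r0; apply: lt_le_trans (qball_lower x r0).
by rewrite mulr_gt0 ?powR_gt0// invr_gt0.
Qed.

(** The two centres are unrelated: the bounds of Q-homogeneity do not depend on the centre. This
    serves both as doubling and to compare balls around different points. *)
Lemma qball_dilate c x y r : (0 < c)%R ->
  mu (qball d x (c * r)) <= (K3 ^+ 2 * c `^ Q)%:E * mu (qball d y r).
Proof.
move=> c0; have [r0|r0] := leP r 0%R.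
  by rewrite !qball_r0 ?measure0 ?mule0// pmulr_rle0.
have cr0 : (0 < c * r)%R by exact: mulr_gt0.
rewrite (qball_fin x cr0) (qball_fin y r0) -EFinM lee_fin.
apply: (le_trans (qball_upper x cr0)); rewrite powRM ?(ltW c0) ?(ltW r0)//.
have h := qball_lower y r0.
have -> : (K3 * (c `^ Q * r `^ Q) =
           K3 ^+ 2 * c `^ Q * (K3^-1 * r `^ Q))%R.
  by field; rewrite gt_eqF.
by rewrite ler_wpM2l// mulr_ge0 ?powR_ge0// exprn_ge0// ltW.
Qed.

(** Bounds the radii of the family to be covered, so that the greedy choice has a finite supremum to
    approach. *)
Lemma radius_bound x r m : (0 < r)%R -> mu (qball d x r) <= m%:E ->
  (r <= (K3 * m) `^ Q^-1)%R.
Proof.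
move=> r0 h; have /andP[h1 _] := homQ x r0.
have := le_trans h1 h; rewrite lee_fin ler_pdivrMl//.
move=> h2; have rQ0 := powR_gt0 Q r0.
have -> : r = ((r `^ Q) `^ Q^-1)%R.
  by rewrite -powRrM mulfV ?gt_eqF// powRr1// ltW.
by rewrite ge0_ler_powR ?nnegrE ?invr_ge0 ?(ltW Q0) ?(le_trans (ltW rQ0)) ?(ltW rQ0).
Qed.

Section selection.
Variables (P : set (X * R)) (b : R).
Hypothesis Pb : forall p, P p -> (0 < p.2 <= b)%R.

(* A radius 0, i.e. an empty ball, encodes that no ball of the family avoids
   the set [U]. *)
Lemma greedy_choice (U : set X) : exists q : X * R,
  [/\ (0 <= q.2)%R,
      (0 < q.2)%R -> P q /\ qball d q.1 q.2 `&` U = set0 &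
      forall p, P p -> qball d p.1 p.2 `&` U = set0 -> (p.2 <= 2 * q.2)%R].
Proof.
pose S := [set p.2 | p in [set p | P p /\ qball d p.1 p.2 `&` U = set0]].
have [[r0 Sr0]|S0] := pselect (exists r, S r); last first.
  exists (point, 0%R); split => //=; first by rewrite ltxx.
  by move=> p Pp pU; exfalso; apply: S0; exists p.2, p.
have supS : has_sup S.
  split; first by exists r0.
  by exists b => _ [p [/Pb/andP[_ pb] _] <-].
have ubS := sup_ubound (proj2 supS).
have S_gt0 : (0 < sup S)%R.
  by apply: lt_le_trans (ubS _ Sr0); case: Sr0 => p [/Pb/andP[p0 _] _] <-.
(* Since the supremum is positive, some admissible radius exceeds half of it. *)
have e0 : (0 < sup S / 2)%R by lra.
have [_ [q [Pq qU] <-] hq] := sup_adherent e0 supS.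
exists q; split => //; first by have /andP[/ltW] := Pb Pq.
move=> p Pp pU; have /ubS : S p.2 by exists p.
by lra.
Qed.

End selection.

(* The Vitali covering argument, with balls chosen greedily: the enlargements
   of a disjoint sequence of balls of the family cover all the centres. *)
Lemma weak_type_covering (P : set (X * R)) (g : X -> \bar R) :
  measurable_fun setT g -> (forall x, 0 <= g x) -> \int[mu]_x g x < +oo ->
  (forall p, P p -> (0 < p.2)%R /\
    mu (qball d p.1 p.2) <= \int[mu]_(x in qball d p.1 p.2) g x) ->
  exists E, [/\ measurable E, forall p, P p -> E p.1 &
    mu E <= (K3 ^+ 2 * (3 * K) `^ Q)%:E * \int[mu]_x g x].
Proof.
move=> mg g0 gfin Pg; set G := \int[mu]_x g x.
have G0 : 0 <= G by exact: integral_ge0.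
have GE : G = (fine G)%:E by rewrite fineK// ge0_fin_numE.
have intG A : measurable A -> \int[mu]_(x in A) g x <= G.
  by move=> mA; apply: ge0_subset_integral.
have Pb p : P p -> (0 < p.2 <= (K3 * fine G) `^ Q^-1)%R.
  move=> /Pg[p0 h]; rewrite p0; apply: (@radius_bound p.1) => //.
  by rewrite -GE (le_trans h)// intG//; exact: qball_measurable.
have [pick pickP] := choice (greedy_choice Pb).
(* [U n] is the union of the first [n] chosen balls and [V n] is the ball chosen next, disjoint from
   [U n]. *)
pose U := fix U n := if n is n'.+1 then
  U n' `|` qball d (pick (U n')).1 (pick (U n')).2 else set0.
pose V n := qball d (pick (U n)).1 (pick (U n)).2.
have VU n : V n `&` U n = set0.
  case: (pickP (U n)) => q0 h _; have [r0|/h[]//] := leP (pick (U n)).2 0%R.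
  by rewrite /V qball_r0// set0I.
have subU m n : (m < n)%N -> V m `<=` U n.
  elim: n => // n IH; rewrite ltnS leq_eqVlt => /orP[/eqP->|/IH]; first by right.
  by move=> h x /h; left.
have tV : trivIset setT V.
  apply: ltn_trivIset => m n nm; apply/seteqP; split => // x [Vm Vn].
  by rewrite -(VU m); split => //; exact: (subU _ _ nm).
have mV n : measurable (V n) by exact: qball_measurable.
have muV n : mu (V n) <= \int[mu]_(x in V n) g x.
  case: (pickP (U n)) => q0 h _; have [r0|/h[/Pg[]//]] := leP (pick (U n)).2 0%R.
  by rewrite /V qball_r0// measure0 integral_set0.
have sumV : \sum_(i <oo) mu (V i) <= G.
  apply: (@le_trans _ _ (\sum_(i <oo) \int[mu]_(x in V i) g x)).
    by apply: lee_nneseries.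
  rewrite -ge0_integral_bigcup//; last exact: measurable_funTS.
  by apply: intG; exact: bigcup_measurable.
(* If a ball of the family meets a chosen ball of radius r and has radius at most 2 r, the
   quasi-triangle inequality puts its centre within K (r + 2 r) = 3 K r of the chosen centre. *)
exists (\bigcup_n qball d (pick (U n)).1 (3 * K * (pick (U n)).2)); split.
- by apply: bigcup_measurable => n _; exact: qball_measurable.
- move=> p Pp; have [p0 _] := Pg _ Pp.
  (* A ball avoiding all chosen balls would force every chosen radius to be at least half of its
     own. The measures of the [V n] would then be bounded below, against [sumV]. *)
  have [n hn] : exists n, qball d p.1 p.2 `&` U n !=set0.
    apply: contrapT => hn.
    have hU n : qball d p.1 p.2 `&` U n = set0.
      by apply/eqP; apply/negPn/negP => /set0P h; apply: hn; exists n.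
    have rp n : (p.2 / 2 <= (pick (U n)).2)%R.
      by case: (pickP (U n)) => _ _ /(_ p Pp (hU n)); lra.
    pose e := (K3^-1 * (p.2 / 2) `^ Q)%R.
    have e0 : (0 < e)%R.
      by rewrite mulr_gt0 ?invr_gt0 ?powR_gt0 ?divr_gt0.
    have eV n : e%:E <= mu (V n).
      have r0 : (0 < (pick (U n)).2)%R by apply: lt_le_trans (rp n); lra.
      rewrite /V qball_fin// lee_fin (le_trans _ (qball_lower _ r0))//.
      rewrite ler_wpM2l ?invr_ge0 ?(ltW K3_gt0)// ge0_ler_powR ?nnegrE ?(ltW Q0)//.
        by rewrite divr_ge0// ltW.
      exact: ltW.
    by have := sumV; rewrite (nneseries_pinfty_ge e0 eV) GE leye_eq.
  have exn : exists n, `[< qball d p.1 p.2 `&` U n !=set0 >].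
    by exists n; apply/asboolP.
  (* The least such index is not 0, as [U 0] is empty. At its predecessor the ball of [p] was still
     a candidate and meets the ball then chosen, so the greedy rule compares the radii. *)
  have [m /asboolP hm mmin] := ex_minnP exn.
  case: m hm mmin => [[x []]//|m] [x [px]] + mmin.
  have Um : qball d p.1 p.2 `&` U m = set0.
    apply/eqP; apply/negPn/negP => /set0P h.
    by have := mmin m; rewrite ltnn => h'; have := h' (asboolT h).
  case=> [Ux|Vx]; first by have : set0 x by rewrite -Um.
  exists m => //; case: (pickP (U m)) => _ _ /(_ p Pp Um) hp.
  rewrite /qball/= in px Vx *.
  case: qd => _ _ dC dT; have := dT (pick (U m)).1 p.1 x.
  rewrite (dC x p.1) => h; have := K_gt0; nra.
- apply: (@le_trans _ _ (\sum_(n <oo)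
      mu (qball d (pick (U n)).1 (3 * K * (pick (U n)).2)))).
    apply: measure_sigma_subadditive => //; first by move=> n; exact: qball_measurable.
    by apply: bigcup_measurable => n _; exact: qball_measurable.
  apply: (@le_trans _ _ (\sum_(n <oo) (K3 ^+ 2 * (3 * K) `^ Q)%:E * mu (V n))).
    by apply: lee_nneseries => // n _; apply: qball_dilate; rewrite mulr_gt0.
  rewrite nneseriesZl// lee_wpmul2l// lee_fin mulr_ge0 ?powR_ge0//.
  by rewrite exprn_ge0// ltW.
Qed.

End covering.

(** * Integrals and modulars *)

Lemma integral_le_affine (R : realType) (disp : measure_display)
    (X : measurableType disp) (mu : {measure set X -> \bar R}) (B : set X)
    (f h : X -> \bar R) (a b : R) :
  measurable B -> measurable_fun B f -> measurable_fun B h ->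
  (forall x, B x -> 0 <= f x) -> (forall x, 0 <= h x) ->
  (0 <= a)%R -> (0 <= b)%R ->
  (forall x, B x -> f x <= a%:E + b%:E * h x) ->
  \int[mu]_(x in B) f x <= a%:E * mu B + b%:E * \int[mu]_(x in B) h x.
Proof.
move=> mB mf mh f0 h0 a0 b0 fh.
have mbh : measurable_fun B (fun x => b%:E * h x) by exact: measurable_funeM.
apply: (@le_trans _ _ (\int[mu]_(x in B) (a%:E + b%:E * h x))).
  apply: ge0_le_integral => //.
  by apply: emeasurable_funD => //; exact: measurable_cst.
rewrite ge0_integralD//; last by move=> x _; rewrite mule_ge0.
by rewrite ge0_integralZl_EFin// integral_cst.
Qed.

Lemma ediv_EFin (R : realType) (x : \bar R) (lam : R) : (0 < lam)%R ->
  x / lam%:E = (lam^-1)%:E * x.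
Proof. by move=> l0; rewrite inver gt_eqF// muleC. Qed.

Lemma ediv_ge0 (R : realType) (x : \bar R) (lam : R) : (0 < lam)%R ->
  0 <= x -> 0 <= x / lam%:E.
Proof. by move=> l0 x0; rewrite ediv_EFin// mule_ge0// lee_fin invr_ge0 ltW. Qed.

Section modular.
Context (R : realType) (disp : measure_display) (X : measurableType disp).
Variables (mu : {measure set X -> \bar R}) (Phi : R -> \bar R).
Hypothesis yPhi : young_Y Phi.
Implicit Types (f g : X -> \bar R) (lam : R).

Lemma le_upper_integral f g : (forall x, f x <= g x) ->
  upper_integral mu f <= upper_integral mu g.
Proof.
move=> fg; apply: le_ereal_inf => _ [h [mh gh] <-]; exists h => //.
by split => // x; exact: le_trans (gh x).
Qed.

Lemma modular_le f g lam lam' : (0 < lam <= lam')%R ->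
  (forall x, `|f x| <= `|g x|) ->
  upper_integral mu (fun x => young_ext Phi (`|g x| / lam%:E)) <= 1 ->
  upper_integral mu (fun x => young_ext Phi (`|f x| / lam'%:E)) <= 1.
Proof.
case/andP => l0 ll fg; apply: le_trans; apply: le_upper_integral => x.
have l0' : (0 < lam')%R by lra.
apply: (young_ext_le yPhi); first exact: ediv_ge0.
rewrite !ediv_EFin// lee_pmul// lee_fin ?invr_ge0 ?(ltW l0')//.
by rewrite lef_pV2// posrE.
Qed.

(** The infimum defining the upper integral need not be attained, whence 2 instead of 1. The
    measurable [h] replaces the modular integrand in all later integrations. *)
Lemma modular_majorant f lam : (0 < lam)%R ->
  upper_integral mu (fun x => young_ext Phi (`|f x| / lam%:E)) <= 1 ->
  exists h, [/\ measurable_fun setT h, forall x, 0 <= h x,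
    forall x, young_ext Phi (`|f x| / lam%:E) <= h x &
    \int[mu]_x h x <= 2%:E].
Proof.
move=> l0 h1.
have : upper_integral mu (fun x => young_ext Phi (`|f x| / lam%:E)) < 2%:E.
  by rewrite (le_lt_trans h1)// lte_fin; lra.
move=> /ereal_inf_lt[_ [h [mh hh] <-] /ltW ?]; exists h; split => // x.
by apply: le_trans (hh x); apply: (young_ext_ge0 yPhi); exact: ediv_ge0.
Qed.

End modular.

(** [young_linear_bound] at v / lam, multiplied by [lam]. The parameter [s] stays free, to fix the
    constant term as each application requires. *)
Lemma young_majorant_affine (R : realType) (Phi : R -> \bar R) (v w : \bar R)
    (s lam : R) : young_Y Phi -> (0 < s)%R -> (0 < lam)%R -> 0 <= v ->
  young_ext Phi (v / lam%:E) <= w ->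
  v <= (s * lam)%:E + (s / fine (Phi s) * lam)%:E * w.
Proof.
move=> yPhi s0 l0 v0 h2.
have Fs0 : (0 < fine (Phi s))%R by exact: (young_gt0 yPhi).
have vl0 : 0 <= v / lam%:E by exact: ediv_ge0.
have h1 := young_linear_bound yPhi s0 vl0.
have w0 : 0 <= w by apply: le_trans h2; exact: (young_ext_ge0 yPhi).
have -> : v = lam%:E * (v / lam%:E).
  by rewrite ediv_EFin// muleA -EFinM divff ?gt_eqF// mul1e.
apply: (@le_trans _ _ (lam%:E * (s%:E + (s / fine (Phi s))%:E * w))).
  rewrite lee_wpmul2l ?lee_fin ?(ltW l0)// (le_trans h1)// leeD2l//.
  by rewrite lee_wpmul2l// lee_fin divr_ge0 ?ltW.
rewrite ge0_muleDr ?lee_fin ?(ltW s0)//; last first.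
  by rewrite mule_ge0// lee_fin divr_ge0// ltW.
by rewrite muleA -!EFinM mulrC [(lam * _)%R]mulrC.
Qed.

(** * Geometric sums and geometric levels *)

(** When terms at least double, a sum is at most twice its last term. Only the largest selected
    index matters: the induction drops unselected top indices, then bounds the full sum below the
    first selected one. *)
Lemma geometric_sum_bound (R : realType) (a : nat -> R) (p : pred nat)
    (w : R) (n : nat) :
  (forall j, 0 <= a j)%R -> (forall j, 2 * a j <= a j.+1)%R ->
  (0 <= w)%R -> (forall j, p j -> (a j <= w)%R) ->
  (\sum_(0 <= j < n | p j) a j <= 2 * w)%R.
Proof.
move=> a0 ha w0 pa.
have full m : (\sum_(0 <= j < m.+1) a j <= 2 * a m)%R.
  elim: m => [|m IH]; first by rewrite big_nat1; have := a0 0%N; lra.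
  by rewrite big_nat_recr//=; have := ha m; lra.
elim: n => [|n IH]; first by rewrite big_geq// mulr_ge0.
have [pn|pn] := boolP (p n); last first.
  by rewrite big_mkcond big_nat_recr//= (negbTE pn) addr0 -big_mkcond.
apply: (@le_trans _ _ (\sum_(0 <= j < n.+1) a j)%R).
  by rewrite big_mkcond; apply: ler_sum => j _; case: ifP.
by apply: (le_trans (full n)); rewrite ler_wpM2l// pa.
Qed.

Lemma geometric_level (R : realType) (c k v : R) :
  (0 < c)%R -> (1 < k)%R -> (c < v)%R ->
  exists2 j, (c * k ^+ j < v)%R & (v <= c * k ^+ j.+1)%R.
Proof.
move=> c0 k1 cv.
have exj : exists j, (v <= c * k ^+ j)%R.
  have bernoulli n : (1 + n%:R * (k - 1) <= k ^+ n)%R.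
    elim: n => [|n IH]; first by rewrite mul0r addr0 expr0.
    rewrite exprS -[n.+1]addn1 natrD.
    apply: (@le_trans _ _ (k * (1 + n%:R * (k - 1)))%R).
      have h : (0 <= n%:R * ((k - 1) * (k - 1)))%R.
        by rewrite mulr_ge0// -expr2 sqr_ge0.
      by move: h; lra.
    by rewrite ler_wpM2l//; lra.
  pose n := (Num.truncn (v / c / (k - 1))).+1; exists n.
  rewrite -ler_pdivrMl// mulrC (le_trans _ (bernoulli n))//.
  have : (v / c / (k - 1) < n%:R)%R by exact: truncnS_gt.
  by rewrite ltr_pdivrMr ?subr_gt0//; lra.
(* The least exponent is not 0 because c < v; its predecessor is the required [j]. *)
have [[|j] vj jmin] := ex_minnP exj.
  by move: vj; rewrite expr0 mulr1 leNgt cv.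
exists j => //; rewrite ltNge; apply/negP => /jmin.
by rewrite ltnn.
Qed.

(** * From superlevel bounds to weak and strong Orlicz norms *)

Section superlevel_estimates.
Context (R : realType) (disp : measure_display) (X : topMeasurableType disp).
Variables (mu : {measure set X -> \bar R}) (Phi : R -> \bar R).
Hypothesis yPhi : young_Y Phi.
Local Notation F r := (fine (Phi r)).
(** In the application [u] is the maximal function, [B] the ball on which it is estimated, [f] the
    original function cut off to a larger ball, and [c] bounds the means over distant balls. *)
Variables (u f : X -> \bar R) (B : set X) (c M C0 lam1 lam : R).
Hypotheses (mB : measurable B) (muB : mu B = M%:E) (M_ge0 : (0 <= M)%R).
Hypotheses (c_gt0 : (0 < c)%R) (C0_ge1 : (1 <= C0)%R).
Hypotheses (lam1_gt0 : (0 < lam1)%R) (lam_gt0 : (0 < lam)%R).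
Hypothesis u_ge0 : forall y, 0 <= u y.
Hypothesis modf :
  upper_integral mu (fun y => young_ext Phi (`|f y| / lam1%:E)) <= 1.
Hypothesis far_bound : (F (c / lam) * M <= 2^-1)%R.
Hypothesis superlevel : forall (t : R) (g : X -> \bar R), (c <= t)%R ->
  measurable_fun setT g -> (forall x, 0 <= g x) -> \int[mu]_x g x < +oo ->
  (forall y, `|f y| <= (t / 2)%:E + (t / 2)%:E * g y) ->
  exists E, [/\ measurable E,
    forall y, B y -> t%:E < u y -> E y & mu E <= C0%:E * \int[mu]_x g x].

Let C0_gt0 : (0 < C0)%R. Proof. exact: lt_le_trans C0_ge1. Qed.

Let abs_restrE y : `|(u \_ B) y| = (u \_ B) y.
Proof. by rewrite gee0_abs// patchE; case: ifP. Qed.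

(** Below level [c] the trivial bound by mu B suffices, by [far_bound]. Above it, the superlevel set
    has outer measure at most 2 C0 / F(s) with s = t / (2 lam1), and convexity gives F(t / lam) <=
    (2 lam1 / lam) F(s), so the product is at most 4 C0 lam1 / lam. *)
Lemma norm_WL_Phi_le_of_superlevel : (4 * C0 * lam1 <= lam)%R ->
  norm_WL_Phi mu Phi (u \_ B) <= lam%:E.
Proof.
move=> l14.
apply: ereal_inf_lbound; exists lam => //; split => //.
apply: ge_ereal_sup => _ [t /= t0 <-].
have tl0 : (0 <= t / lam)%R by rewrite divr_ge0// ltW.
have F0 := young_ge0 yPhi tl0.
rewrite (young_fin yPhi tl0).
have supB : [set y | t%:E < `|(u \_ B) y|] `<=` B `&` [set y | t%:E < u y].
  move=> y /=; rewrite abs_restrE patchE; case: ifPn => [|_].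
    by rewrite inE.
  by rewrite ltNge lee_fin ltW.
have [tc|ct] := ltP t c.
  apply: (@le_trans _ _ ((F (t / lam))%:E * mu B)).
    rewrite lee_wpmul2l ?lee_fin// -(measurable_mu_extE mu mB).
    by apply: le_mu_ext => y /supB[].
  rewrite muB -EFinM lee_fin.
  apply: (@le_trans _ _ (F (c / lam) * M)%R); last first.
    by apply: (le_trans far_bound); lra.
  rewrite ler_wpM2r// (young_le yPhi)// ler_wpM2r ?invr_ge0 ?(ltW lam_gt0)//.
  exact: ltW.
have [h [mh h0 hh hI]] := modular_majorant yPhi lam1_gt0 modf.
(* Chosen so that s lam1 = t / 2, which gives the affine majorant the shape [superlevel] asks
   for. *)
pose s := (t / (2 * lam1))%R.
have s0 : (0 < s)%R by rewrite divr_gt0// mulr_gt0.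
have Fs0 := young_gt0 yPhi s0.
have gI : \int[mu]_x (((F s)^-1)%:E * h x) <= (2 / F s)%:E.
  rewrite ge0_integralZl_EFin ?invr_ge0 ?(ltW Fs0)//.
  by rewrite muleC EFinM lee_wpmul2r// lee_fin invr_ge0 ltW.
have [||||E [mE BE muE]] := @superlevel t (fun x => ((F s)^-1)%:E * h x) ct.
- exact: measurable_funeM.
- by move=> x; rewrite mule_ge0// lee_fin invr_ge0 ltW.
- by apply: le_lt_trans gI _; rewrite ltry.
- move=> y; have := young_majorant_affine yPhi s0 lam1_gt0 (abse_ge0 _) (hh y).
  have -> : (s / F s * lam1 = s * lam1 / F s)%R by rewrite mulrAC.
  have -> : (s * lam1 = t / 2)%R.
    by rewrite /s; field; rewrite gt_eqF.
  by rewrite muleA -EFinM.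
apply: (@le_trans _ _ ((F (t / lam))%:E * (C0%:E * (2 / F s)%:E))).
  rewrite lee_wpmul2l ?lee_fin//.
  apply: (@le_trans _ _ (mu E)).
    rewrite -(measurable_mu_extE mu mE).
    by apply: le_mu_ext => y /supB[]; exact: BE.
  by rewrite (le_trans muE)// lee_wpmul2l// lee_fin ltW.
rewrite -!EFinM lee_fin.
have th : (0 <= 2 * lam1 / lam <= 1)%R.
  apply/andP; split; first by rewrite divr_ge0 ?mulr_ge0// ltW.
  by rewrite ler_pdivrMr// mul1r; have := C0_ge1; have := lam1_gt0; nra.
have := young_scale yPhi th (ltW s0).
have -> : (2 * lam1 / lam * s = t / lam)%R by rewrite /s; field; rewrite !gt_eqF.
move=> h3.
have -> : (F (t / lam) * (C0 * (2 / F s)) = F (t / lam) / F s * (2 * C0))%R by ring.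
apply: (@le_trans _ _ (2 * lam1 / lam * (2 * C0))%R).
  by rewrite ler_wpM2r ?mulr_ge0 ?(ltW C0_gt0)// ler_pdivrMr.
have -> : (2 * lam1 / lam * (2 * C0) = 4 * C0 * lam1 / lam)%R by ring.
by rewrite ler_pdivrMr// mul1r.
Qed.

Section nabla2.
Variable k : R.
Hypotheses (k_gt1 : (1 < k)%R)
  (nabla : forall r, (0 <= r)%R -> Phi r <= ((2 * k)^-1)%:E * Phi (k * r)%R).
Hypothesis f_int : mu.-integrable setT f.

(** The layers are t_j < u <= t_(j+1). [F_ j] takes the upper end, hence dominates Phi(u / lam) on
    its layer. *)
Let t_ j := (c * k ^+ j)%R.
Let F_ j := F (t_ j.+1 / lam).
Let k_gt0 : (0 < k)%R. Proof. exact: lt_trans k_gt1. Qed.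
Let t_gt0 j : (0 < t_ j)%R.
Proof. by rewrite mulr_gt0// exprn_gt0. Qed.
Let t_ge j : (c <= t_ j)%R.
Proof. by rewrite ler_peMr ?(ltW c_gt0)// exprn_ege1// ltW. Qed.
Let tl_ge0 j : (0 <= t_ j / lam)%R.
Proof. by rewrite divr_ge0// ltW. Qed.
Let F_gt0 j : (0 < F_ j)%R.
Proof. by apply: (young_gt0 yPhi); rewrite divr_gt0. Qed.
Let tS j : t_ j.+1 = (k * t_ j)%R.
Proof. by rewrite /t_ exprS mulrCA. Qed.

(** One step of nabla_2 multiplies [F_] by at least 2 k, while the level grows only by [k]. *)
Let F_double j : (2 * (F_ j / t_ j) <= F_ j.+1 / t_ j.+1)%R.
Proof.
have := nabla (tl_ge0 j.+1).
have -> : (k * (t_ j.+1 / lam) = t_ j.+2 / lam)%R by rewrite [t_ j.+2]tS mulrA.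
rewrite (young_fin yPhi (tl_ge0 j.+1)) (young_fin yPhi (tl_ge0 j.+2)).
rewrite -EFinM lee_fin => h.
have kt : (0 < k * t_ j)%R by apply: mulr_gt0.
rewrite tS ler_pdivlMr//.
have -> : (2 * (F_ j / t_ j) * (k * t_ j) = 2 * k * F_ j)%R.
  by field; rewrite gt_eqF.
by rewrite -ler_pdivlMl// mulr_gt0.
Qed.

Let g_ j : X -> \bar R := fun y =>
  if (t_ j / 2)%:E < `|f y| then (2 / t_ j)%:E * `|f y| else 0.

Let g_ge0 j y : 0 <= g_ j y.
Proof. by rewrite /g_; case: ifP => // _; rewrite mule_ge0// lee_fin divr_ge0// ltW. Qed.

Let mf : measurable_fun setT f. Proof. exact: measurable_int f_int. Qed.

Let g_meas j : measurable_fun setT (g_ j).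
Proof.
have mS : measurable [set y | (t_ j / 2)%:E < `|f y|].
  rewrite -[X in measurable X]setTI.
  by apply: emeasurable_fun_o_infty => //; exact: measurableT_comp.
have -> : g_ j = (fun y => (2 / t_ j)%:E * `|f y|) \_
    [set y | (t_ j / 2)%:E < `|f y|].
  by apply/funext => y; rewrite patchE /g_ mem_setE.
apply/(measurable_restrictT _ _).1 => //; apply: measurable_funTS.
by apply: measurable_funeM; exact: measurableT_comp.
Qed.

Let g_int j : \int[mu]_x g_ j x < +oo.
Proof.
apply: (@le_lt_trans _ _ (\int[mu]_x ((2 / t_ j)%:E * `|f x|))).
  apply: ge0_le_integral => //; first by apply: measurable_funeM; exact: measurableT_comp.
  move=> y _; rewrite /g_; case: ifP => // _.
  by rewrite mule_ge0// lee_fin divr_ge0// ltW.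
rewrite ge0_integralZl_EFin//; last 2 first.
- exact: measurableT_comp.
- by rewrite divr_ge0// ltW.
by case/integrableP: f_int => _ fi; rewrite lte_mul_pinfty// lee_fin divr_ge0// ltW.
Qed.

Let g_bound j y : `|f y| <= (t_ j / 2)%:E + (t_ j / 2)%:E * g_ j y.
Proof.
have t2 : (0 <= t_ j / 2)%R by rewrite divr_ge0// ltW.
rewrite /g_; case: ifPn => [_|]; last by rewrite mule0 adde0 -leNgt.
rewrite muleA -EFinM.
have -> : (t_ j / 2 * (2 / t_ j) = 1)%R by field; rewrite gt_eqF.
by rewrite mul1e leeDr.
Qed.

(** Only levels t_j < 2 |f y| contribute, with terms 2 |f y| F_j / t_j that at least double by
    [F_double]. Convexity bounds each contributing term by Phi(2 k |f y| / lam); the factor k arises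
    because [F_ j] is taken at t_(j+1) = k t_j. *)
Let g_sum y : \sum_(j <oo) ((F_ j)%:E * g_ j y) <=
  2%:E * young_ext Phi ((2 * k / lam)%:E * `|f y|).
Proof.
have kl0 : (0 < 2 * k / lam)%R by rewrite divr_gt0// mulr_gt0.
have Fg0 j : 0 <= (F_ j)%:E * g_ j y by rewrite mule_ge0// lee_fin ltW.
have := abse_ge0 (f y).
case Ev : (`|f y|) => [r||]//; last first.
  by move=> _; rewrite gt0_muley ?lte_fin// [young_ext _ _]/= gt0_muley ?lte_fin// leey.
rewrite lee_fin => r0.
have klr0 : (0 <= 2 * k / lam * r)%R by rewrite mulr_ge0// ltW.
rewrite -EFinM /young_ext (young_fin yPhi klr0) -EFinM.
pose a j := (2 * r * (F_ j / t_ j))%R.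
pose p j := (t_ j < 2 * r)%R.
apply: lime_le; first exact: is_cvg_nneseries.
apply: nearW => n.
rewrite (eq_bigr (fun j => (if p j then a j else 0%R)%:E)); last first.
  move=> j _; rewrite /g_ Ev lte_fin /p ltr_pdivrMr// [(r * 2)%R]mulrC.
  case: ifP => _; last by rewrite mule0.
  by rewrite -!EFinM /a; congr EFin; ring.
rewrite sumEFin lee_fin -big_mkcond.
apply: geometric_sum_bound.
- by move=> j; rewrite !mulr_ge0 ?invr_ge0// ltW.
- by move=> j; rewrite /a mulrCA ler_wpM2l ?mulr_ge0.
- exact: young_ge0.
move=> j; rewrite /p => tr.
have r20 : (0 < 2 * r)%R by exact: lt_trans tr.
have th : (0 <= t_ j / (2 * r) <= 1)%R.
  by rewrite divr_ge0 ?(ltW (t_gt0 _)) ?(ltW r20)//= ler_pdivrMr// mul1r ltW.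
have := young_scale yPhi th klr0.
have -> : (t_ j / (2 * r) * (2 * k / lam * r) = t_ j.+1 / lam)%R.
  rewrite tS; field; rewrite !gt_eqF// ; lra.
rewrite -/(F_ j) => h.
rewrite /a mulrA ler_pdivrMr// -ler_pdivlMl// (le_trans h)// le_eqVlt; apply/orP; left.
by apply/eqP; ring.
Qed.

(** Half of the unit modular is spent on values up to [c], through [far_bound]; the layers cost at
    most 8 C0 k lam1 / lam, which the hypothesis makes at most the other half. *)
Lemma norm_L_Phi_le_of_superlevel : (16 * C0 * k * lam1 <= lam)%R ->
  norm_L_Phi mu Phi (u \_ B) <= lam%:E.
Proof.
move=> l116; apply: ereal_inf_lbound; exists lam => //; split => //.
have [E HE] := choice (fun j =>
  superlevel (t_ge j) (g_meas j) (g_ge0 j) (g_int j) (g_bound j)).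
have mE j : measurable (E j) by case: (HE j).
(* [H] is a layer-cake majorant of the modular of [u]; it is measurable although
   [u] need not be. *)
pose H y := (F (c / lam))%:E * (\1_B y)%:E +
  \sum_(j <oo) ((F_ j)%:E * (\1_(E j) y)%:E).
have cl0 : (0 < c / lam)%R by rewrite divr_gt0.
have Fc0 := young_gt0 yPhi cl0.
have s0 j y : 0 <= (F_ j)%:E * (\1_(E j) y)%:E.
  by rewrite -EFinM lee_fin mulr_ge0 ?(ltW (F_gt0 _)).
have H0 y : 0 <= \sum_(j <oo) ((F_ j)%:E * (\1_(E j) y)%:E) by exact: nneseries_ge0.
have b0 y : 0 <= (F (c / lam))%:E * (\1_B y)%:E.
  by rewrite -EFinM lee_fin mulr_ge0// ltW.
have mind (A : set X) (a : R) : measurable A ->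
    measurable_fun setT (fun y => a%:E * (\1_A y)%:E).
  by move=> mA; apply: measurable_funeM; apply/measurable_EFinP; exact: measurable_indic.
have iind (A : set X) (a : R) : measurable A -> (0 <= a)%R ->
    \int[mu]_y (a%:E * (\1_A y)%:E) = a%:E * mu A.
  move=> mA a0; rewrite ge0_integralZl_EFin//; last first.
    by apply/measurable_EFinP; exact: measurable_indic.
  by rewrite integral_indic// setIT.
have mS : measurable_fun setT (fun y => \sum_(j <oo) ((F_ j)%:E * (\1_(E j) y)%:E)).
  by apply: (@ge0_emeasurable_sum _ _ _ setT _ xpredT) => // j _; exact: mind.
have mH : measurable_fun setT H.
  by apply: emeasurable_funD => //; exact: mind.
apply: (@le_trans _ _ (\int[mu]_y H y)).
  apply: ereal_inf_lbound; exists H => //; split => // y.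
  have Hge0 : 0 <= H y by exact: adde_ge0.
  rewrite abs_restrE patchE; case: ifPn => [|_]; last first.
    by rewrite mul0e /=; case: yPhi => -[_ _ _ [-> _] _] _.
  rewrite inE => By; case Eu : (u y) (u_ge0 y) => [v||]// v0; last first.
    (* At an infinite value [y] lies in every [E j], and the weights [F_ j] are bounded below by F(c
       / lam), so the series diverges. *)
    suff -> : H y = +oo by exact: leey.
    have bN : (F (c / lam))%:E * (\1_B y)%:E != -oo.
      by rewrite gt_eqF// (lt_le_trans _ (b0 y))// ltNyr.
    suff E_oo : \sum_(j <oo) ((F_ j)%:E * (\1_(E j) y)%:E) = +oo.
      by rewrite /H E_oo addey.
    apply: nneseries_pinfty_ge Fc0 _.
    move=> j; have [_ /(_ y By) + _] := HE j.
    rewrite Eu ltry => /(_ isT) Ey; rewrite indicE mem_set// mule1 lee_fin.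
    apply: (young_le yPhi); first exact: ltW.
    by rewrite ler_wpM2r ?invr_ge0 ?(ltW lam_gt0).
  rewrite lee_fin in v0.
  have vl0 : (0 <= v / lam)%R by rewrite divr_ge0// ltW.
  rewrite ediv_EFin// -EFinM mulrC /young_ext (young_fin yPhi vl0).
  have [vc|cv] := leP v c.
    apply: (@le_trans _ _ (F (c / lam))%:E).
      by rewrite lee_fin (young_le yPhi)// ler_wpM2r ?invr_ge0 ?(ltW lam_gt0).
    by rewrite /H indicE mem_set// mule1 leeDl.
  have [j tv vt] : exists2 j, (t_ j < v)%R & (v <= t_ j.+1)%R.
    exact: geometric_level.
  apply: (@le_trans _ _ ((F_ j)%:E * (\1_(E j) y)%:E)).
    have [_ /(_ y By) + _] := HE j.
    rewrite Eu lte_fin tv => /(_ isT) Ey; rewrite indicE mem_set// mule1 lee_fin.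
    by rewrite (young_le yPhi)// ler_wpM2r ?invr_ge0 ?(ltW lam_gt0).
  apply: (le_trans (@nneseries_ge_term _ (fun j => (F_ j)%:E * (\1_(E j) y)%:E) j _)) => //.
  by rewrite /H leeDr.
rewrite ge0_integralD//; last exact: mind.
rewrite iind ?(ltW Fc0)// muB -EFinM.
have -> : 1 = (2^-1)%:E + (2^-1)%:E :> \bar R by rewrite -EFinD; congr EFin; lra.
apply: leeD; first by rewrite lee_fin.
rewrite integral_nneseries//; last by move=> j; exact: mind.
apply: (@le_trans _ _ (\sum_(j <oo) (C0%:E * \int[mu]_y ((F_ j)%:E * g_ j y)))).
  apply: lee_nneseries => [j _ _|j _]; first exact: integral_ge0.
  rewrite iind ?(ltW (F_gt0 _))// ge0_integralZl_EFin ?(ltW (F_gt0 _))//.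
  by rewrite muleCA lee_wpmul2l ?lee_fin ?(ltW (F_gt0 _))//; case: (HE j).
have Fg0 j y : 0 <= (F_ j)%:E * g_ j y by rewrite mule_ge0// lee_fin ltW.
have mFg j : measurable_fun setT (fun y => (F_ j)%:E * g_ j y) by exact: measurable_funeM.
rewrite nneseriesZl; last by move=> j _; exact: integral_ge0.
rewrite -integral_nneseries//.
have [h [mh h0 hh hI]] := modular_majorant yPhi lam1_gt0 modf.
(* Passes from the scale lam / (2 k) of [g_sum] to [lam1]; as th <= 1, convexity lets it out as a
   factor. *)
pose th := (2 * k * lam1 / lam)%R.
have th01 : (0 < th <= 1)%R.
  rewrite divr_gt0 ?mulr_gt0//= ler_pdivrMr// mul1r.
  have kl : (0 < k * lam1)%R by rewrite mulr_gt0.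
  by have := C0_ge1; nra.
have th0 : (0 < th)%R by case/andP: th01.
apply: (@le_trans _ _ (C0%:E * \int[mu]_y ((2 * th)%:E * h y))).
  rewrite lee_wpmul2l ?lee_fin ?(ltW C0_gt0)//.
  apply: ge0_le_integral => //.
  - by move=> y _; exact: nneseries_ge0.
  - by apply: (@ge0_emeasurable_sum _ _ _ setT _ xpredT).
  - exact: measurable_funeM.
  move=> y _; apply: (le_trans (g_sum y)).
  have -> : (2 * k / lam)%:E * `|f y| = th%:E * (`|f y| / lam1%:E).
    rewrite ediv_EFin// muleA -EFinM; congr (_%:E * _).
    by rewrite /th; field; rewrite !gt_eqF.
  have yl0 : 0 <= `|f y| / lam1%:E by exact: ediv_ge0.
  rewrite [(2 * th)%:E]EFinM -[leRHS]muleA lee_wpmul2l ?lee_fin//.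
  apply: (le_trans (young_ext_scale yPhi th01 yl0)).
  by rewrite lee_wpmul2l ?lee_fin ?(ltW th0).
have th40 : (0 <= 2 * th)%R by rewrite mulr_ge0// ltW.
rewrite ge0_integralZl_EFin//.
apply: (@le_trans _ _ (C0%:E * ((2 * th)%:E * 2%:E))).
  by rewrite lee_wpmul2l ?lee_fin ?(ltW C0_gt0)// lee_wpmul2l.
rewrite -!EFinM lee_fin /th.
have -> : (C0 * (2 * (2 * k * lam1 / lam) * 2) =
  2^-1 * (16 * C0 * k * lam1) / lam)%R by field; rewrite gt_eqF.
by rewrite ler_pdivrMr// ler_wpM2l.
Qed.

End nabla2.
End superlevel_estimates.

(** * Local estimates of the maximal function *)

Section maximal_function.
Context (R : realType) (disp : measure_display) (X : topMeasurableType disp).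
Variables (mu : {measure set X -> \bar R}) (d : X -> X -> R) (Q K K3 : R).
Variable Phi : R -> \bar R.
Hypotheses (Q0 : (0 < Q)%R) (K_ge1 : (1 <= K)%R) (K3_ge1 : (1 <= K3)%R).
Hypothesis qd : quasi_distance d K.
Hypothesis mball : forall x (r : R), (0 < r)%R -> measurable (qball d x r).
Hypothesis homQ : forall x (r : R), (0 < r)%R ->
  (K3^-1 * r `^ Q)%:E <= mu (qball d x r) <= (K3 * r `^ Q)%:E.
Hypothesis yPhi : young_Y Phi.
Implicit Types (x y z : X) (r s t : R).

Let K_gt0 : (0 < K)%R. Proof. exact: lt_le_trans K_ge1. Qed.
Let K3_gt0 : (0 < K3)%R. Proof. exact: lt_le_trans K3_ge1. Qed.

Local Notation F r := (fine (Phi r)).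
Local Notation I s := (fine (young_inv Phi s%:E)).
Local Notation m x r := (fine (mu (qball d x r))).

Let m_gt0 x r : (0 < r)%R -> (0 < m x r)%R.
Proof. by move=> r0; exact: (qball_gt0 K3_ge1 homQ). Qed.

Let muE x r : (0 < r)%R -> mu (qball d x r) = (m x r)%:E.
Proof. by move=> r0; exact: (qball_fin homQ). Qed.

Let mB x r : measurable (qball d x r).
Proof. exact: (qball_measurable qd mball). Qed.

Let powN_gt0 r : (0 < r)%R -> (0 < r `^ (- Q))%R.
Proof. exact: powR_gt0. Qed.

(** With its converse below, this exchanges the measure of a ball for r^Q inside the inverse at the
    cost of [K3], by [young_invr_scale]. *)
Lemma young_inv_ball_le x r : (0 < r)%R ->
  (I (m x r)^-1 <= K3 * I (r `^ (- Q)))%R.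
Proof.
move=> r0; apply: le_trans (young_invr_scale yPhi K3_ge1 (powN_gt0 r0)).
apply: (young_invr_le yPhi); first by rewrite invr_gt0 m_gt0.
rewrite powRN -[K3 in leRHS]invrK -invfM lef_pV2 ?posrE ?m_gt0//.
  exact: (qball_lower homQ).
by rewrite mulr_gt0 ?invr_gt0 ?powR_gt0.
Qed.

Lemma young_inv_ball_ge x r : (0 < r)%R ->
  (I (r `^ (- Q)) <= K3 * I (m x r)^-1)%R.
Proof.
move=> r0; have mi : (0 < (m x r)^-1)%R by rewrite invr_gt0 m_gt0.
apply: le_trans (young_invr_scale yPhi K3_ge1 mi).
apply: (young_invr_le yPhi); first exact: powN_gt0.
rewrite powRN ler_pdivlMr ?m_gt0// ler_pdivrMl ?powR_gt0// mulrC.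
exact: (qball_upper homQ).
Qed.

Variable f : X -> \bar R.
Hypothesis locf : forall x r, (0 < r)%R -> mu.-integrable setT (f \_ (qball d x r)).

Lemma loc_measurable x r : measurable_fun (qball d x r) (fun y => `|f y|).
Proof.
have [r0|r0] := leP r 0%R.
  by rewrite (qball_r0 qd)//; exact: measurable_fun_set0.
apply: measurableT_comp => //; apply/measurable_restrictT => //.
exact: measurable_int (locf x r0).
Qed.

(** Plays the role of Hölder's inequality against the indicator of the ball. Integrating the affine
    majorant gives s lam m from the constant and at most 2 s lam / F(s) <= 2 s lam m from the
    modular. *)
Lemma mean_le x r lam : (0 < r)%R -> (0 < lam)%R ->
  upper_integral mu (fun y =>
    young_ext Phi (`|(f \_ (qball d x r)) y| / lam%:E)) <= 1 ->
  \int[mu]_(y in qball d x r) `|f y| <=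
    (6 * lam * I (m x r)^-1 * m x r)%:E.
Proof.
move=> r0 l0 /(modular_majorant yPhi l0)[h [mh h0 hh hI]].
have m0 := m_gt0 x r0.
have mi : (0 < (m x r)^-1)%R by rewrite invr_gt0.
set u := I _; have [_ u0 uP _] := young_inv_fin yPhi mi; rewrite -/u in u0 uP.
(* Twice the inverse, since F exceeds 1 / m only strictly beyond [u]; this makes 3 s equal to 6
   u. *)
pose s := (2 * u)%R; have s0 : (0 < s)%R by rewrite /s; lra.
have Fs : ((m x r)^-1 < F s)%R by apply: uP; rewrite -/u /s; lra.
have Fs0 : (0 < F s)%R by lra.
apply: (@le_trans _ _ ((s * lam)%:E * mu (qball d x r) +
    (s / F s * lam)%:E * \int[mu]_(y in qball d x r) h y)).
  apply: integral_le_affine => //.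
  - exact: loc_measurable.
  - exact: measurable_funTS.
  - by rewrite mulr_ge0 ?ltW.
  - by rewrite mulr_ge0 ?divr_ge0 ?ltW.
  move=> y By; have := hh y; rewrite patchE mem_set// => hy.
  exact: young_majorant_affine hy.
have -> : (6 * lam * u * m x r = s * lam * m x r + 2 * s * lam * m x r)%R.
  by rewrite /s; ring.
rewrite muE// EFinD leeD// -?EFinM//.
apply: (@le_trans _ _ ((s / F s * lam)%:E * 2%:E)).
  rewrite lee_wpmul2l//; first by rewrite lee_fin mulr_ge0 ?divr_ge0// ltW.
  by apply: le_trans hI; apply: ge0_subset_integral.
rewrite -EFinM lee_fin.
have Fi : ((F s)^-1 <= m x r)%R.
  by rewrite -[leRHS]invrK lef_pV2 ?posrE ?invr_gt0// ltW.
have -> : (s / F s * lam * 2 = 2 * s * lam * (F s)^-1)%R by ring.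
have sl0 : (0 < s * lam)%R by exact: mulr_gt0.
by rewrite ler_wpM2l// -mulrA mulr_ge0// ltW.
Qed.

(** [D] will be a constant times [phi2 r0]. Kept abstract, it carries all that is needed of the
    Morrey condition at this ball. *)
Variables (x0 : X) (r0 D : R).
Hypotheses (r0_gt0 : (0 < r0)%R) (D_gt0 : (0 < D)%R).
Hypothesis modD : forall t, (r0 < t)%R -> upper_integral mu (fun y =>
  young_ext Phi (`|(f \_ (qball d x0 t)) y| / (D / I (t `^ (- Q)))%:E)) <= 1.

(** The inverse in the scale of [modD] cancels the one in [mean_le] up to [K3], so the bound on the
    mean does not depend on [t]. *)
Lemma mean_concentric t : (r0 < t)%R ->
  \int[mu]_(y in qball d x0 t) `|f y| <= (6 * K3 * D * m x0 t)%:E.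
Proof.
move=> rt; have t0 : (0 < t)%R by apply: lt_trans rt.
have It0 : (0 < I (t `^ (- Q)))%R by apply: (young_invr_gt0 yPhi); exact: powN_gt0.
have l0 : (0 < D / I (t `^ (- Q)))%R by rewrite divr_gt0.
apply: le_trans (mean_le t0 l0 (modD rt)) _.
rewrite lee_fin ler_wpM2r ?(ltW (m_gt0 _ _))//.
have -> : (6 * (D / I (t `^ (- Q))) * I (m x0 t)^-1 =
  6 * D * (I (m x0 t)^-1 / I (t `^ (- Q))))%R by ring.
have -> : (6 * K3 * D = 6 * D * K3)%R by ring.
rewrite ler_wpM2l//; first by rewrite mulr_ge0// ltW.
by rewrite ler_pdivrMr// young_inv_ball_le.
Qed.

Local Notation kap := ((2 * K) `^ Q)%R.
Local Notation c := (6 * K3 * D * (K3 ^+ 2 * kap))%R.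

Lemma mean_far y s : qball d x0 r0 y -> (r0 < s)%R ->
  \int[mu]_(z in qball d y s) `|f z| <= (c * m y s)%:E.
Proof.
move=> yB rs; have s0 : (0 < s)%R by apply: lt_trans rs.
have K2 : (0 < 2 * K)%R by rewrite mulr_gt0.
have rKs : (r0 < 2 * K * s)%R by have := K_ge1; nra.
have sub : qball d y s `<=` qball d x0 (2 * K * s).
  move=> z; rewrite /qball/= in yB *; case: qd => _ _ _ /(_ x0 z y).
  by have := K_gt0; nra.
apply: (@le_trans _ _ (\int[mu]_(z in qball d x0 (2 * K * s)) `|f z|)).
  by apply: ge0_subset_integral => //; exact: loc_measurable.
apply: (le_trans (mean_concentric rKs)).
have := qball_dilate K3_ge1 qd homQ x0 y s K2.
rewrite (muE x0) ?mulr_gt0// (muE y)// -EFinM lee_fin => h.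
rewrite lee_fin /c -[leRHS]mulrA ler_wpM2l//.
by rewrite mulr_ge0 ?(ltW D_gt0)// mulr_ge0// ltW.
Qed.

(** By [mean_far], a ball centred in B(x0, r0) with mean of |f| above t >= c has radius at most r0,
    so it only sees the cut-off function. Its mean of [g] then exceeds 1, which is the hypothesis of
    [weak_type_covering]. *)
Lemma maximal_superlevel t g : (c <= t)%R ->
  measurable_fun setT g -> (forall x, 0 <= g x) -> \int[mu]_x g x < +oo ->
  (forall y, `|(f \_ (qball d x0 (2 * K * r0))) y| <=
    (t / 2)%:E + (t / 2)%:E * g y) ->
  exists E, [/\ measurable E,
    forall y, qball d x0 r0 y -> t%:E < maximal mu d f y -> E y &
    mu E <= (K3 ^+ 2 * (3 * K) `^ Q)%:E * \int[mu]_x g x].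
Proof.
move=> ct mg g_ge0 gfin fg.
have t0 : (0 < t)%R.
  apply: lt_le_trans ct; rewrite /c !mulr_gt0 ?exprn_gt0 ?powR_gt0//.
  by rewrite mulr_gt0.
pose P := [set p : X * R | [/\ qball d x0 r0 p.1, (0 < p.2)%R &
   (t * m p.1 p.2)%:E < \int[mu]_(z in qball d p.1 p.2) `|f z|]].
have [|E [mE PE muE']] := @weak_type_covering _ _ _ _ _ _ _ _ Q0 K_ge1 K3_ge1 qd
    mball homQ P g mg g_ge0 gfin.
  move=> [y s]/= [By s0 /= hs]; split => //.
  have sr : (s <= r0)%R.
    rewrite leNgt; apply/negP => rs; have := lt_le_trans hs (mean_far By rs).
    by rewrite lte_fin ltr_pM2r ?m_gt0// ltNge ct.
  have sub : qball d y s `<=` qball d x0 (2 * K * r0).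
    move=> z; rewrite /qball/= in By *; case: qd => _ _ _ /(_ x0 z y).
    by have := K_gt0; nra.
  have h : \int[mu]_(z in qball d y s) `|f z| <=
      (t / 2)%:E * mu (qball d y s) + (t / 2)%:E * \int[mu]_(z in qball d y s) g z.
    apply: integral_le_affine => //; rewrite ?divr_ge0 ?(ltW t0)//.
    - exact: loc_measurable.
    - exact: measurable_funTS.
    - by move=> z /sub Bz; have := fg z; rewrite patchE mem_set.
  have := lt_le_trans hs h; rewrite muE// -EFinM.
  have Ig0 : 0 <= \int[mu]_(z in qball d y s) g z by exact: integral_ge0.
  case: (\int[mu]_(z in qball d y s) g z) Ig0 => [v||]//; last first.
    by move=> _ _; rewrite leey.
  rewrite -EFinM -EFinD lte_fin !lee_fin => v0.
  by rewrite -mulrDr mulrAC -mulrA ltr_pM2l//; lra.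
exists E; split => // y By /ereal_sup_gt[_ [s /= s0 <-]].
rewrite muE// inver gt_eqF ?m_gt0// lte_pdivlMl ?m_gt0// => h.
by apply: (PE (y, s)); split => //=; rewrite mulrC EFinM.
Qed.


Local Notation C0 := (K3 ^+ 2 * (3 * K) `^ Q)%R.
Local Notation lam1 := (D / I ((2 * K * r0) `^ (- Q)))%R.

Let kap_ge1 : (1 <= kap)%R.
Proof.
have K2 : (1 <= 2 * K)%R by have := K_ge1; lra.
by rewrite -[leLHS](powRr0 (2 * K)); apply: ler_powR => //; exact: ltW.
Qed.

Let C0_ge1 : (1 <= C0)%R.
Proof.
have K3K : (1 <= 3 * K)%R by have := K_ge1; lra.
rewrite -[leLHS]mulr1 ler_pM ?exprn_ege1//.
by rewrite -[leLHS](powRr0 (3 * K)); apply: ler_powR => //; exact: ltW.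
Qed.

Let Kr0_gt : (r0 < 2 * K * r0)%R.
Proof. by have := K_ge1; have := r0_gt0; nra. Qed.

Let Kr0_gt0 : (0 < 2 * K * r0)%R. Proof. exact: lt_trans Kr0_gt. Qed.

Let Ipow_gt0 r : (0 < r)%R -> (0 < I (r `^ (- Q)))%R.
Proof. by move=> r_gt0; apply: (young_invr_gt0 yPhi); exact: powN_gt0. Qed.

Let lam1_gt0 : (0 < lam1)%R.
Proof. by rewrite divr_gt0 ?Ipow_gt0. Qed.

Lemma maximal_ge0 y : 0 <= maximal mu d f y.
Proof.
apply: ereal_sup_ge; exists ((mu (qball d y 1))^-1 *
    \int[mu]_(z in qball d y 1) `|f z|); first by exists 1%R => /=.
by rewrite muE// inver gt_eqF ?m_gt0// mule_ge0 ?integral_ge0.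
Qed.

Variable L : R.
Local Notation lam := (L * D / I (r0 `^ (- Q)))%R.
Hypothesis L_far : (24 * K3 ^+ 4 * kap <= L)%R.

Let L_gt0 : (0 < L)%R.
Proof.
have kap0 : (0 < kap)%R by exact: lt_le_trans kap_ge1.
by apply: lt_le_trans L_far; rewrite !mulr_gt0 ?exprn_gt0.
Qed.

Let lam_gt0 : (0 < lam)%R. Proof. by rewrite !mulr_gt0 ?invr_gt0 ?Ipow_gt0. Qed.

(** The lower bound on [L] puts 2 c / lam at no more than half of the inverse at 1 / m, hence
    strictly below it, where F is at most 1 / m. Halving the argument gains the factor 1/2 by
    convexity. *)
Lemma young_far_bound : (F (c / lam) * m x0 r0 <= 2^-1)%R.
Proof.
have mi : (0 < (m x0 r0)^-1)%R by rewrite invr_gt0 m_gt0.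
have [_ b0 _ uP] := young_inv_fin yPhi mi.
have kap0 : (0 < kap)%R by exact: lt_le_trans kap_ge1.
have c0 : (0 < c)%R by rewrite !mulr_gt0 ?exprn_gt0.
have cl : (2 * (c / lam) <= I (m x0 r0)^-1 / 2)%R.
  move: (young_inv_ball_ge x0 r0_gt0) (Ipow_gt0 r0_gt0) b0 L_gt0 L_far kap0 D_gt0.
  move: (I (r0 `^ (- Q))) (I (m x0 r0)^-1) kap K3_gt0.
  move: D L K3 => D' L' k3 a b kp k30 ab a0 b0 L0 Lf kp0 D0.
  have -> : (2 * (6 * k3 * D' * (k3 ^+ 2 * kp) / (L' * D' / a)) =
             12 * k3 ^+ 3 * kp * a / L')%R.
    by field; rewrite !gt_eqF.
  rewrite ler_pdivrMr// [leRHS]mulrC.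
  apply: (@le_trans _ _ (12 * k3 ^+ 3 * kp * (k3 * b))%R).
    by rewrite ler_wpM2l// !mulr_ge0 ?exprn_ge0// ltW.
  have -> : (12 * k3 ^+ 3 * kp * (k3 * b) = 24 * k3 ^+ 4 * kp * (b / 2))%R.
    by rewrite !exprS; field.
  by rewrite ler_wpM2r// divr_ge0// ltW.
have cl0 : (0 < c / lam)%R by rewrite divr_gt0.
have h : (F (2 * (c / lam)) <= (m x0 r0)^-1)%R by apply: uP; lra.
have i2 : (0 <= (2^-1 : R) <= 1)%R by apply/andP; split; lra.
have cl20 : (0 <= 2 * (c / lam))%R by rewrite mulr_ge0// ltW.
have := young_scale yPhi i2 cl20; rewrite mulKf// => h2.
by rewrite -ler_pdivlMr ?m_gt0//; apply: le_trans h2 _; rewrite ler_wpM2l.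
Qed.

(** [lam1] belongs to the ball of radius 2 K r0 and [lam] to that of radius r0; concavity of the
    inverse limits the loss to the factor (2 K)^Q. *)
Lemma scale_comparable A : (0 <= A)%R -> (A * kap <= L)%R ->
  (A * lam1 <= lam)%R.
Proof.
move=> A0 AL.
have h : (I (r0 `^ (- Q)) <= kap * I ((2 * K * r0) `^ (- Q)))%R.
  have := young_invr_scale yPhi kap_ge1 (powN_gt0 Kr0_gt0).
  congr (I _ <= _)%R.
  have K2 : (0 < 2 * K)%R by rewrite mulr_gt0.
  rewrite (@powRM _ (2 * K)) ?(ltW r0_gt0) ?(ltW K2)//.
  by rewrite powRN mulrA mulfV ?mul1r// gt_eqF// powR_gt0.
move: h (Ipow_gt0 r0_gt0) (Ipow_gt0 Kr0_gt0) AL D_gt0 A0.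
move: (I (r0 `^ (- Q))) (I ((2 * K * r0) `^ (- Q))) kap.
move=> a b kp h a0 b0 AL D0 A0.
rewrite mulrA ler_pdivrMr// mulrAC ler_pdivlMr//.
apply: (@le_trans _ _ (A * D * (kp * b))%R).
  by rewrite ler_wpM2l// mulr_ge0// ltW.
have -> : (A * D * (kp * b) = A * kp * (D * b))%R by ring.
by rewrite -[leRHS]mulrA ler_wpM2r// mulr_ge0// ltW.
Qed.

Lemma maximal_weak_orlicz : (4 * C0 * kap <= L)%R ->
  norm_WL_Phi mu Phi (maximal mu d f \_ (qball d x0 r0)) <= lam%:E.
Proof.
move=> L4; have C00 : (0 <= 4 * C0)%R by rewrite mulr_ge0// (le_trans _ C0_ge1).
apply: (norm_WL_Phi_le_of_superlevel yPhi _ (muE x0 r0_gt0) (ltW (m_gt0 _ _)) C0_ge1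
  lam1_gt0 lam_gt0 maximal_ge0 (modD Kr0_gt) young_far_bound) => //.
- exact: maximal_superlevel.
- exact: scale_comparable.
Qed.

Lemma maximal_strong_orlicz k : (1 < k)%R ->
  (forall r, (0 <= r)%R -> Phi r <= ((2 * k)^-1)%:E * Phi (k * r)%R) ->
  (16 * C0 * k * kap <= L)%R ->
  norm_L_Phi mu Phi (maximal mu d f \_ (qball d x0 r0)) <= lam%:E.
Proof.
move=> k1 nabla L16.
have C00 : (0 <= 16 * C0 * k)%R.
  have C1 : (0 <= C0)%R by exact: le_trans C0_ge1.
  by apply: mulr_ge0; [exact: mulr_ge0 | exact/ltW/(lt_trans _ k1)].
have kap0 : (0 < kap)%R by exact: lt_le_trans kap_ge1.
have c0 : (0 < c)%R by rewrite !mulr_gt0 ?exprn_gt0.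
apply: (norm_L_Phi_le_of_superlevel yPhi _ (muE x0 r0_gt0) c0 C0_ge1
  lam1_gt0 lam_gt0 maximal_ge0 (modD Kr0_gt) young_far_bound _ k1 nabla) => //.
- exact: maximal_superlevel.
- exact: locf.
- exact: scale_comparable.
Qed.

End maximal_function.

(** * From the supremum-infimum condition to Morrey norms *)

Lemma ess_inf_gt_ge (R : realType) (t : R) (g : R -> \bar R) (a : \bar R) :
  (forall s, (t < s)%R -> a <= g s) -> a <= ess_inf_gt t g.
Proof.
move=> ag; apply: ereal_sup_ubound => /=.
(* The complement of the half-line is null for the restricted measure, so nothing is asked of [g]
   there. *)
exists (~` `]t, +oo[%classic); split.
- by apply: measurableC; exact: measurable_itv.
- by rewrite /mrestr setICl measure0.
- move=> s /= ags ts; apply: ags; apply: ag.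
  by move: ts; rewrite in_itv/= andbT.
Qed.

Section orlicz_morrey_bound.
Context (R : realType) (disp : measure_display) (X : topMeasurableType disp).
Variables (mu : {measure set X -> \bar R}) (d : X -> X -> R) (Q K3 : R).
Variables (Phi : R -> \bar R) (phi1 phi2 : R -> R).
Hypothesis K3_ge1 : (1 <= K3)%R.
Hypothesis homQ : forall x (r : R), (0 < r)%R ->
  (K3^-1 * r `^ Q)%:E <= mu (qball d x r) <= (K3 * r `^ Q)%:E.
Hypothesis yPhi : young_Y Phi.
Hypotheses (phi1_gt0 : forall r : R, (0 < r)%R -> (0 < phi1 r)%R)
  (phi2_gt0 : forall r : R, (0 < r)%R -> (0 < phi2 r)%R).
Local Notation I s := (fine (young_inv Phi s%:E)).
Local Notation m x r := (fine (mu (qball d x r))).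

Let K3_gt0 : (0 < K3)%R. Proof. exact: lt_le_trans K3_ge1. Qed.

Lemma norm_L_Phi_ge0 f : 0 <= norm_L_Phi mu Phi f.
Proof. by apply: le_ereal_inf_tmp => _ [l [l0 _] <-]; rewrite lee_fin ltW. Qed.

Lemma norm_L_Phi_le f g : (forall x, `|f x| <= `|g x|) ->
  norm_L_Phi mu Phi f <= norm_L_Phi mu Phi g.
Proof.
move=> fg; apply: le_ereal_inf => _ [l [l0 hl] <-]; exists l => //; split => //.
by apply: (modular_le yPhi _ fg hl); rewrite l0 lexx.
Qed.

Lemma young_inv_ballE x (r : R) : (0 < r)%R ->
  young_inv Phi (mu (qball d x r))^-1 = (I (m x r)^-1)%:E /\
  (0 < I (m x r)^-1)%R.
Proof.
move=> r0; have m0 := qball_gt0 K3_ge1 homQ x r0.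
rewrite (qball_fin homQ x r0) inver gt_eqF//=.
by have mi : (0 < (m x r)^-1)%R; [rewrite invr_gt0|case: (young_inv_fin yPhi mi)].
Qed.

Variables (f : X -> \bar R) (C A : R).
Hypotheses (C_gt0 : (0 < C)%R) (A_gt0 : (0 < A)%R).
Hypothesis fA : norm_M mu d Phi phi1 f <= A%:E.
Hypothesis hphi : forall r : R, (0 < r)%R ->
  ereal_sup [set young_inv Phi (t `^ (- Q))%:E *
                 ess_inf_gt t
                   (fun s => (phi1 s)%:E / young_inv Phi (s `^ (- Q))%:E)
            | t in [set t : R | (r < t)%R]] <= C%:E * (phi2 r)%:E.

Lemma norm_L_Phi_ball_le x (s : R) : (0 < s)%R ->
  norm_L_Phi mu Phi (f \_ (qball d x s)) <=
  (K3 * A)%:E * ((phi1 s)%:E / young_inv Phi (s `^ (- Q))%:E).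
Proof.
move=> s0; have [Ei i0] := young_inv_ballE x s0.
have p0 := phi1_gt0 s0.
have sQ : (0 < s `^ (- Q))%R by exact: powR_gt0.
have [EI I0 _ _] := young_inv_fin yPhi sQ.
have : ((phi1 s)^-1)%:E * young_inv Phi (mu (qball d x s))^-1 *
    norm_L_Phi mu Phi (f \_ (qball d x s)) <= A%:E.
  by apply: le_trans fA; apply: ereal_sup_ubound; exists (x, s).
rewrite Ei EI inver gt_eqF// -!EFinM.
have b0 : (0 < (phi1 s)^-1 * I (m x s)^-1)%R by rewrite mulr_gt0 ?invr_gt0.
rewrite -[X in X%:E * _]invrK lee_pdivrMl ?invr_gt0// -EFinM => /le_trans; apply.
rewrite lee_fin invfM invrK.
have h := young_inv_ball_ge K3_ge1 homQ yPhi x s0.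
move: h I0 i0 p0.
move: (I (s `^ (- Q))) (I (m x s)^-1) (phi1 s) => a b p h a0 b0' p0.
have -> : (p / b * A = p * A / b)%R by ring.
have -> : (K3 * A * (p / a) = p * A * (K3 / a))%R by ring.
rewrite ler_wpM2l ?mulr_ge0 ?(ltW p0) ?(ltW A_gt0)//.
by rewrite ler_pdivlMr// mulrC ler_pdivrMr.
Qed.

(** For every s > t the norm over B(x, t) is at most that over B(x, s), hence, up to K3 A, a lower
    bound for the function under the essential infimum. *)
Lemma modular_ball_le x (r t : R) : (0 < r)%R -> (r < t)%R ->
  upper_integral mu (fun y => young_ext Phi (`|(f \_ (qball d x t)) y| /
    (2 * C * K3 * A * phi2 r / I (t `^ (- Q)))%:E)) <= 1.
Proof.
move=> r0 rt; have t0 : (0 < t)%R by exact: lt_trans rt.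
have tQ : (0 < t `^ (- Q))%R by exact: powR_gt0.
have [EI I0 _ _] := young_inv_fin yPhi tQ.
have p0 := phi2_gt0 r0.
have KA0 : (0 < K3 * A)%R by exact: mulr_gt0.
set N := norm_L_Phi mu Phi (f \_ (qball d x t)).
have Ninf : ((K3 * A)^-1)%:E * N <=
    ess_inf_gt t (fun s => (phi1 s)%:E / young_inv Phi (s `^ (- Q))%:E).
  apply: ess_inf_gt_ge => s ts; rewrite lee_pdivrMl//.
  apply: le_trans (norm_L_Phi_ball_le x (lt_trans t0 ts)).
  apply: norm_L_Phi_le => y; rewrite !patchE; case: ifPn => [|_].
    rewrite inE => yt; rewrite mem_set// /qball/=.
    exact: lt_trans yt ts.
  by rewrite abse0 abse_ge0.
have : young_inv Phi (t `^ (- Q))%:E * (((K3 * A)^-1)%:E * N) <= (C * phi2 r)%:E.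
  rewrite EFinM; apply: le_trans (hphi r0).
  apply: (@le_trans _ _ (young_inv Phi (t `^ (- Q))%:E *
      ess_inf_gt t (fun s => (phi1 s)%:E / young_inv Phi (s `^ (- Q))%:E))).
    by rewrite EI lee_wpmul2l// lee_fin ltW.
  by apply: ereal_sup_ubound; exists t.
rewrite EI muleA -EFinM.
have c0 : (0 < I (t `^ (- Q)) / (K3 * A))%R by exact: divr_gt0.
rewrite -[X in X%:E * _]invrK lee_pdivrMl ?invr_gt0// -EFinM => hN.
(* The factor 2 makes the inequality strict, so an admissible scale lies below the stated one even
   if the norm is not attained. *)
have : N < (2 * C * K3 * A * phi2 r / I (t `^ (- Q)))%:E.
  apply: (le_lt_trans hN); rewrite lte_fin invfM invrK.
  have -> : (2 * C * K3 * A * phi2 r / I (t `^ (- Q)) =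
    2 * ((I (t `^ (- Q)))^-1 * (K3 * A) * (C * phi2 r)))%R by ring.
  by rewrite ltr_pMl ?ltr1n// mulr_gt0 ?mulr_gt0 ?invr_gt0.
move=> /ereal_inf_lt[_ [l [l0 hl] <-]]; rewrite lte_fin => /ltW ll.
apply: (modular_le yPhi _ _ hl) => //.
by rewrite l0.
Qed.

(** The norm [N] is abstract so that the weak and strong statements share this step; [phi2 r]
    cancels against the one in [D]. *)
Lemma morrey_norm_maximal_le (N : (X -> \bar R) -> \bar R) (L : R) :
  (0 < L)%R ->
  (forall x (r D : R), (0 < r)%R -> (0 < D)%R ->
    (forall t : R, (r < t)%R -> upper_integral mu (fun y =>
      young_ext Phi (`|(f \_ (qball d x t)) y| / (D / I (t `^ (- Q)))%:E)) <= 1) ->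
    N (maximal mu d f \_ (qball d x r)) <= (L * D / I (r `^ (- Q)))%:E) ->
  morrey_norm mu d N Phi phi2 (maximal mu d f) <=
    (2 * C * K3 ^+ 2 * L * A)%:E.
Proof.
move=> L0 hN; apply: ge_ereal_sup => _ [[x r] /= r0 <-].
have p0 := phi2_gt0 r0; have [Ei i0] := young_inv_ballE x r0.
pose D := (2 * C * K3 * A * phi2 r)%R.
have D0 : (0 < D)%R by rewrite !mulr_gt0.
have rQ : (0 < r `^ (- Q))%R by exact: powR_gt0.
have I0 := young_invr_gt0 yPhi rQ.
rewrite Ei -EFinM.
apply: (@le_trans _ _ (((phi2 r)^-1 * I (m x r)^-1)%:E *
    (L * D / I (r `^ (- Q)))%:E)).
  rewrite lee_wpmul2l// ?lee_fin ?mulr_ge0 ?invr_ge0 ?(ltW p0) ?(ltW i0)//.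
  by apply: hN => // t rt; exact: modular_ball_le.
rewrite -EFinM lee_fin.
have h := young_inv_ball_le K3_ge1 homQ yPhi x r0.
move: h I0 i0 p0; rewrite /D.
move: (I (r `^ (- Q))) (I (m x r)^-1) (phi2 r) => a b p h a0 b0' p0.
have -> : (p^-1 * b * (L * (2 * C * K3 * A * p) / a) =
  2 * C * K3 * L * A * (b / a))%R by field; rewrite !gt_eqF.
have -> : (2 * C * K3 ^+ 2 * L * A = 2 * C * K3 * L * A * K3)%R by ring.
rewrite ler_wpM2l//; first by rewrite !mulr_ge0// ltW.
by rewrite ler_pdivrMr.
Qed.

End orlicz_morrey_bound.

Lemma bounded_maximal_orlicz_morrey (R : realType) (disp : measure_display)
    (X : topMeasurableType disp) (mu : {measure set X -> \bar R})
    (d : X -> X -> R) (Q K3 : R) (Phi : R -> \bar R) (phi1 phi2 : R -> R)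
    (N : (X -> \bar R) -> \bar R) (L C : R) :
  (1 <= K3)%R ->
  (forall x (r : R), (0 < r)%R ->
    (K3^-1 * r `^ Q)%:E <= mu (qball d x r) <= (K3 * r `^ Q)%:E) ->
  young_Y Phi ->
  (forall r : R, (0 < r)%R -> (0 < phi1 r)%R) ->
  (forall r : R, (0 < r)%R -> (0 < phi2 r)%R) ->
  (0 < C)%R ->
  (forall r : R, (0 < r)%R ->
    ereal_sup [set young_inv Phi (t `^ (- Q))%:E *
                   ess_inf_gt t
                     (fun s => (phi1 s)%:E / young_inv Phi (s `^ (- Q))%:E)
              | t in [set t : R | (r < t)%R]] <= C%:E * (phi2 r)%:E) ->
  (0 < L)%R ->
  (forall f : X -> \bar R,
    (forall x r, (0 < r)%R -> mu.-integrable setT (f \_ (qball d x r))) ->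
    forall x (r D : R), (0 < r)%R -> (0 < D)%R ->
    (forall t : R, (r < t)%R -> upper_integral mu (fun y =>
      young_ext Phi (`|(f \_ (qball d x t)) y| /
        (D / fine (young_inv Phi (t `^ (- Q))%:E))%:E)) <= 1) ->
    N (maximal mu d f \_ (qball d x r)) <=
      (L * D / fine (young_inv Phi (r `^ (- Q))%:E))%:E) ->
  bounded_operator (maximal mu d) (orlicz_morrey mu d Phi phi1)
    (norm_M mu d Phi phi1) (morrey_norm mu d N Phi phi2).
Proof.
move=> K31 homQ yPhi p1 p2 C0 hphi L0 hN.
pose C1 := (2 * C * K3 ^+ 2 * L)%R.
have K30 : (0 < K3)%R by exact: lt_le_trans K31.
have C10 : (0 < C1)%R by rewrite !mulr_gt0 ?exprn_gt0.
exists C1 => // f [locf fin].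
have int_f x r : (0 < r)%R -> mu.-integrable setT (f \_ (qball d x r)).
  (* Restricting twice to the same ball extracts integrability of [f] on it. *)
  by move=> r0; have [/(_ x r r0) + _] := locf x r r0; rewrite -patch_setI setIid.
have nM0 : 0 <= norm_M mu d Phi phi1 f.
  apply: ereal_sup_ge; exists (((phi1 1)^-1)%:E *
      young_inv Phi (mu (qball d point 1))^-1 *
      norm_L_Phi mu Phi (f \_ (qball d point 1))).
    by exists (point, 1%R) => /=.
  have [-> i0] := young_inv_ballE K31 homQ yPhi point (@ltr01 R).
  by rewrite mule_ge0 ?norm_L_Phi_ge0// -EFinM lee_fin mulr_ge0 ?invr_ge0// ltW// p1.
have nME : norm_M mu d Phi phi1 f = (fine (norm_M mu d Phi phi1 f))%:E.
  by rewrite fineK// ge0_fin_numE.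
rewrite nME in nM0 *; move: (fine _) nME nM0 => n nME; rewrite lee_fin => n0.
apply/lee_addgt0Pr => e e0.
(* The norm may be 0 whereas the preceding estimates need a positive bound; the excess costs exactly
   [e] after multiplication by [C1]. *)
have A0 : (0 < n + e / C1)%R by rewrite ltr_wpDl// divr_gt0.
have fA : norm_M mu d Phi phi1 f <= (n + e / C1)%:E.
  by rewrite nME lee_fin lerDl ltW// divr_gt0.
apply: (le_trans (morrey_norm_maximal_le K31 homQ yPhi p1 p2 C0 A0 fA hphi L0
  (hN f int_f))).
by rewrite -EFinM -EFinD lee_fin -/C1 mulrDr mulrCA divff ?mulr1// gt_eqF.
Qed.

Unset Implicit Arguments.

Theorem theorem4p3 (R : realType) (disp : measure_display)
    (X : topMeasurableType disp) (mu : {measure set X -> \bar R})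
    (d : X -> X -> R) (Q : R)
    (Phi : R -> \bar R) (phi1 phi2 : R -> R)
    (hX : homogeneous_type mu d)
    (hinfinite : mu [set: X] = +oo)
    (hdense : Cc_dense_in_L1 mu)
    (hQ0 : (0 < Q)%R)
    (hQ : Q_homogeneous mu d Q)
    (hPhi : young_Y Phi)
    (mphi1 : lebesgue_measurable_pos phi1)
    (phi1_gt0 : forall r, (0 < r)%R -> (0 < phi1 r)%R)
    (mphi2 : lebesgue_measurable_pos phi2)
    (phi2_gt0 : forall r, (0 < r)%R -> (0 < phi2 r)%R)
    (hphi : exists2 C : R, (0 < C)%R & forall r, (0 < r)%R ->
      ereal_sup [set young_inv Phi (t `^ (- Q))%:E *
                     ess_inf_gt t
                       (fun s => (phi1 s)%:E / young_inv Phi (s `^ (- Q))%:E)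
                | t in [set t : R | (r < t)%R]]
      <= C%:E * (phi2 r)%:E) :
  bounded_operator (maximal mu d) (orlicz_morrey mu d Phi phi1)
    (norm_M mu d Phi phi1) (norm_WM mu d Phi phi2) /\
  (nabla2 Phi ->
   bounded_operator (maximal mu d) (orlicz_morrey mu d Phi phi1)
     (norm_M mu d Phi phi1) (norm_M mu d Phi phi2)).
Proof.
have [[K K1 qd] _ mball _] := hX.
have [K3 K31 homQ] := hQ.
have [C C0 hC] := hphi.
have K30 : (0 < K3)%R by exact: lt_le_trans K31.
have K0 : (0 < K)%R by exact: lt_le_trans K1.
set kap := ((2 * K) `^ Q)%R; set C3 := (K3 ^+ 2 * (3 * K) `^ Q)%R.
have kap0 : (0 < kap)%R by rewrite powR_gt0// mulr_gt0.
have C30 : (0 < C3)%R by rewrite mulr_gt0 ?exprn_gt0// powR_gt0// mulr_gt0.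
have far0 : (0 < 24 * K3 ^+ 4 * kap)%R by rewrite !mulr_gt0 ?exprn_gt0.
split.
  have weak0 : (0 < 4 * C3 * kap)%R by apply: mulr_gt0 => //; exact: mulr_gt0.
  (* [L] is the sum of the two lower bounds required of it, one for distant balls and one for the
     covering; the strong case below does the same with [k] entering the second. *)
  refine (@bounded_maximal_orlicz_morrey R disp X mu d Q K3 Phi phi1 phi2
    (norm_WL_Phi mu Phi) (24 * K3 ^+ 4 * kap + 4 * C3 * kap)%R C
    K31 homQ hPhi phi1_gt0 phi2_gt0 C0 hC (addr_gt0 far0 weak0) _).
  move=> f int_f x r D r0 D0 modD.
  apply: (maximal_weak_orlicz hQ0 K1 K31 qd mball homQ hPhi int_f r0 D0 modD).
    by rewrite lerDl ltW.
  by rewrite lerDr ltW.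
move=> [k k1 nabla].
have k0 : (0 < k)%R by exact: lt_trans k1.
have strong0 : (0 < 16 * C3 * k * kap)%R.
  by apply: mulr_gt0 => //; apply: mulr_gt0 => //; exact: mulr_gt0.
refine (@bounded_maximal_orlicz_morrey R disp X mu d Q K3 Phi phi1 phi2
  (norm_L_Phi mu Phi) (24 * K3 ^+ 4 * kap + 16 * C3 * k * kap)%R C
  K31 homQ hPhi phi1_gt0 phi2_gt0 C0 hC (addr_gt0 far0 strong0) _).
move=> f int_f x r D r0 D0 modD.
apply: (maximal_strong_orlicz hQ0 K1 K31 qd mball homQ hPhi int_f r0 D0 modD _ k1 nabla).
  by rewrite lerDl ltW.
by rewrite lerDr ltW.
Qed.
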